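(* Let $X$ be a Peano continuum (a nonempty compact, connected, locally path connected metrizable space), and let $H_1(X)$ be its first singular homology group. For an abelian group $A$ let $\mathrm{tor}(A)$ be its torsion subgroup and $\mathrm{tf}(A) = A/\mathrm{tor}(A)$. If $\mathrm{card}(\mathrm{tf}(H_1(X))) < 2^{\aleph_0}$, then $H_1(X)$ is a direct sum of cyclic groups and $\mathrm{tor}(H_1(X))$ is of bounded exponent.
   Context: A Peano continuum is a path connected, locally path connected, compact metrizable space. $\mathrm{tor}(A)$ denotes the subgroup of torsion elements of an abelian group $A$, and $\mathrm{tf}(A)$ the quotient $A/\mathrm{tor}(A)$. *)

(* Defs.v *)
From HB Require Import structures.
From mathcomp Require Import all_boot all_order all_algebra.
From mathcomp Require Import all_classical all_reals all_analysis.
From mathcomp Require Import Rstruct Rstruct_topology.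
From mathcomp Require Import lra.
Set Implicit Arguments. Unset Strict Implicit. Unset Printing Implicit Defensive.
Import Order.TTheory GRing.Theory Num.Theory.
Local Open Scope classical_set_scope.
Local Open Scope ring_scope.

Notation RR := Rdefinitions.R.

Definition Delta1 : Type := set_type (`[0, 1]%classic : set RR).

Lemma Delta1_0 : (0 : RR) \in (`[0, 1]%classic : set RR).
Proof. by apply/mem_set; rewrite /= in_itv /= lexx ler01. Qed.
Lemma Delta1_1 : (1 : RR) \in (`[0, 1]%classic : set RR).
Proof. by apply/mem_set; rewrite /= in_itv /= lexx ler01. Qed.
Definition d1zero : Delta1 := SigSub Delta1_0.
Definition d1one : Delta1 := SigSub Delta1_1.

(** The standard 2-simplex, realised as {(s,t) | s,t >= 0, s+t <= 1} in R^2,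
    with vertices e0 = (0,0), e1 = (1,0), e2 = (0,1). *)
Definition tri : set (RR * RR) :=
  [set p | 0 <= p.1 /\ 0 <= p.2 /\ p.1 + p.2 <= 1].
Definition Delta2 : Type := set_type tri.

Lemma Delta1_bounds (t : Delta1) : 0 <= val t /\ val t <= 1.
Proof. by have := set_valP t; rewrite /= in_itv /= => /andP. Qed.

(* face i : Delta1 -> Delta2 is the affine edge omitting vertex i *)
Lemma face0_in (t : Delta1) : (1 - val t, val t) \in tri.
Proof. have [h0 h1] := Delta1_bounds t. rewrite /= in h0 h1. apply/mem_set; rewrite /tri /=; split; [|split]; lra. Qed.
Lemma face1_in (t : Delta1) : (0, val t) \in tri.
Proof. have [h0 h1] := Delta1_bounds t. rewrite /= in h0 h1. apply/mem_set; rewrite /tri /=; split; [|split]; lra. Qed.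
Lemma face2_in (t : Delta1) : (val t, 0) \in tri.
Proof. have [h0 h1] := Delta1_bounds t. rewrite /= in h0 h1. apply/mem_set; rewrite /tri /=; split; [|split]; lra. Qed.

Definition face0 (t : Delta1) : Delta2 := SigSub (face0_in t). (* e1 -> e2 *)
Definition face1 (t : Delta1) : Delta2 := SigSub (face1_in t). (* e0 -> e2 *)
Definition face2 (t : Delta1) : Delta2 := SigSub (face2_in t). (* e0 -> e1 *)

(** Singular chains as finite formal Z-linear combinations (lists of
    coefficient/simplex pairs); two lists represent the same chain iff all
    coefficients agree. *)
Definition chain (S : Type) := seq (int * S).

Definition coef {S : eqType} (c : chain S) (s : S) : int :=
  \sum_(p <- c | p.2 == s) p.1.

Definition chain_eq {S : eqType} (c d : chain S) : Prop :=
  forall s, coef c s = coef d s.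

Definition cscale {S : Type} (n : int) (c : chain S) : chain S :=
  [seq (n * p.1, p.2) | p <- c].

Definition csub {S : Type} (c d : chain S) : chain S := c ++ cscale (-1) d.

Section Homology.
Variable X : topologicalType.

Definition sing1 := Delta1 -> X.
Definition sing2 := Delta2 -> X.

Definition bd1 (c : chain sing1) : chain X :=
  flatten [seq [:: (p.1, p.2 d1one); (- p.1, p.2 d1zero)] | p <- c].

Definition bd2 (c : chain sing2) : chain sing1 :=
  flatten [seq [:: (p.1, p.2 \o face0); (- p.1, p.2 \o face1); (p.1, p.2 \o face2)]
          | p <- c].

Definition sing_chain1 (c : chain sing1) : Prop := forall p, p \in c -> continuous p.2.
Definition sing_chain2 (c : chain sing2) : Prop := forall p, p \in c -> continuous p.2.

Definition cycle1 (z : chain sing1) : Prop :=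
  sing_chain1 z /\ chain_eq (bd1 z) [::].

Definition boundary1 (z : chain sing1) : Prop :=
  exists w : chain sing2, sing_chain2 w /\ chain_eq z (bd2 w).

Definition homologous (z z' : chain sing1) : Prop := boundary1 (csub z z').

Definition torsion1 (z : chain sing1) : Prop :=
  exists n : nat, (0 < n)%N /\ boundary1 (cscale n%:Z z).

Definition tor_H1_bounded_exponent : Prop :=
  exists N : nat, (0 < N)%N /\
    forall z, cycle1 z -> torsion1 z -> boundary1 (cscale N%:Z z).

(* card (tf(H_1(X))) < 2^aleph_0 : there is no injection of (nat -> bool)
   into H_1(X)/tor(H_1(X)) *)
Definition tf_H1_card_lt_continuum : Prop :=
  ~ exists f : (nat -> bool) -> chain sing1,
      (forall a, cycle1 (f a)) /\
      (forall a b, a <> b -> ~ torsion1 (csub (f a) (f b))).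

Definition comb {I : Type} (g : I -> chain sing1) (l : seq I) (n : I -> int)
  : chain sing1 := flatten [seq cscale (n i) (g i) | i <- l].

(* H_1(X) is the (internal) direct sum of the cyclic subgroups generated by
   the classes [g i], i in I *)
Definition H1_direct_sum_of_cyclic : Prop :=
  exists (I : eqType) (g : I -> chain sing1),
    (forall i, cycle1 (g i)) /\
    (forall z, cycle1 z -> exists (l : seq I) (n : I -> int), homologous z (comb g l n)) /\
    (forall (l : seq I) (n : I -> int), uniq l -> boundary1 (comb g l n) ->
        forall i, i \in l -> boundary1 (cscale (n i) (g i))).

End Homology.

Definition path_connected_set {X : topologicalType} (V : set X) : Prop :=
  forall a b, V a -> V b -> exists f : Delta1 -> X,
    continuous f /\ f d1zero = a /\ f d1one = b /\ (forall t, V (f t)).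

Definition locally_path_connected (X : topologicalType) : Prop :=
  forall (x : X) (U : set X), nbhs x U ->
    exists V : set X, nbhs x V /\ V `<=` U /\ path_connected_set V.

(* a metrizable space is presented as a pseudometric space (over the reals)
   whose topology is Hausdorff, i.e. the pseudometric is a metric *)
Definition peano_continuum (X : pseudoMetricType RR) : Prop :=
  [set: X] !=set0 /\ hausdorff_space X /\ compact [set: X] /\
  connected [set: X] /\ locally_path_connected X.

(* Main.v *)
Require Import Defs.
From HB Require Import structures.
From mathcomp Require Import all_boot all_order all_algebra.
From mathcomp Require Import all_classical all_reals all_analysis.
From mathcomp Require Import Rstruct Rstruct_topology.
From mathcomp Require Import zify ring lra.
(* [charge] also defines a [cscale]. *)
Import Defs.
Set Implicit Arguments. Unset Strict Implicit. Unset Printing Implicit Defensive.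
Import Order.TTheory GRing.Theory Num.Theory numFieldNormedType.Exports.
Local Open Scope classical_set_scope.
Local Open Scope ring_scope.

(** Call a point [x] bad if for every [e > 0] and [N > 0] some loop at [x] inside
    the ball of radius [e] has a homology class not killed by [N].

    If [x] is bad, choose loops [lam k] at [x] of size [1 / (k + 1)] with
    [k! [lam k] <> 0] and let [phi a], for [a] in [2^N], run through those [lam k]
    with [a k = 1].  The relation [n! (phi a - phi b) = 0] on [2^N] is analytic.  If
    it were not meager it would contain [(a, b)] and [(a', b)] where [a] and [a']
    differ exactly at some [k >= n], and then [n! [lam k] = 0].  So the relation
    "[phi a - phi b] is torsion" is meager, and Mycielski's theorem gives continuum
    many [phi a] that are distinct modulo torsion.

    If no point is bad, compactness gives [N] and [d > 0] such that [N] kills all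
    loops of size [d].  Approximating paths by paths in a finite net then shows that
    [N H_1] lies in a finitely generated group, so some multiple of [H_1] is
    finitely generated and free; and [A] is a direct sum of cyclic groups as
    soon as [p A] is, for [p] prime. *)

(** * Abelian groups with a finitely generated multiple *)

Section Algebra.
Variable Q : zmodType.
Implicit Types (A H E : set Q) (s l : seq Q).

Definition subgroup A := A 0 /\ forall x y, A x -> A y -> A (x - y).

Lemma subgroupN A x : subgroup A -> A x -> A (- x).
Proof. by move=> [A0 AB] Ax; rewrite -(add0r (- x)); apply: AB. Qed.

Lemma subgroupD A x y : subgroup A -> A x -> A y -> A (x + y).
Proof.
by move=> hA Ax Ay; rewrite -(opprK y); apply: hA.2 => //; apply: subgroupN.
Qed.

Lemma subgroupMn A x n : subgroup A -> A x -> A (x *+ n).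
Proof.
move=> hA Ax; elim: n => [|n IH]; first by rewrite mulr0n; exact: hA.1.
by rewrite mulrS; apply: subgroupD.
Qed.

Lemma subgroupMz A x (n : int) : subgroup A -> A x -> A (x *~ n).
Proof.
move=> hA Ax; case: n => n; first by rewrite -pmulrn; apply: subgroupMn.
by rewrite NegzE mulrNz -pmulrn; apply: subgroupN => //; apply: subgroupMn.
Qed.

Lemma subgroup_sum A (I : eqType) (r : seq I) (f : I -> Q) :
  subgroup A -> (forall i, i \in r -> A (f i)) -> A (\sum_(i <- r) f i).
Proof.
move=> hA; elim: r => [|i r IH] h; first by rewrite big_nil; exact: hA.1.
rewrite big_cons; apply: subgroupD => //; first by apply: h; rewrite mem_head.
by apply: IH => j hj; apply: h; rewrite in_cons hj orbT.
Qed.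

Definition mulset (k : nat) A : set Q := [set x *+ k | x in A].

Lemma subgroup_mulset k A : subgroup A -> subgroup (mulset k A).
Proof.
move=> hA; split; first by exists 0; [exact: hA.1|rewrite mul0rn].
by move=> _ _ [x Ax <-] [y Ay <-]; exists (x - y); [apply: hA.2|rewrite mulrnBl].
Qed.

(** Recursive, so that an element of [span (a :: s)] comes with its coefficient along [a]; the
    inductions on generators below rest on this splitting. *)
Fixpoint span s : set Q :=
  if s is a :: s' then
    [set x | exists n : int, exists2 y, span s' y & x = a *~ n + y]
  else [set 0].

Lemma subgroup_span s : subgroup (span s).
Proof.
elim: s => [|a s [IH0 IHB]] /=; first by split=> // x y -> ->; rewrite subr0.
split; first by exists 0, 0; rewrite // mulr0z addr0.
move=> _ _ [n [y hy ->]] [m [z hz ->]]; exists (n - m), (y - z); first exact: IHB.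
by rewrite mulrzBr opprD addrACA.
Qed.

Lemma span_mem s x : x \in s -> span s x.
Proof.
elim: s => //= a s IH; rewrite in_cons => /orP[/eqP->|xs].
  by exists 1, 0; [exact: (subgroup_span s).1|rewrite mulr1z addr0].
by exists 0, x; [exact: IH|rewrite mulr0z add0r].
Qed.

Lemma span_muln k s y :
  span [seq a *+ k | a <- s] y -> exists2 x, span s x & y = x *+ k.
Proof.
elim: s y => [|a s IH] y /=; first by move=> ->; exists 0; rewrite ?mul0rn.
move=> [n [z /IH [w hw ->] ->]]; exists (a *~ n + w); first by exists n, w.
by rewrite mulrnDl !pmulrn -!mulrzA mulrC.
Qed.

Lemma span_mulnE k s x : span s x -> span [seq a *+ k | a <- s] (x *+ k).
Proof.
elim: s x => [|a s IH] x /=; first by move=> ->; rewrite mul0rn.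
move=> [n [z /IH hz ->]]; exists n, (z *+ k) => //.
by rewrite mulrnDl !pmulrn -!mulrzA mulrC.
Qed.

Definition torsion x := exists2 k : nat, (0 < k)%N & x *+ k = 0 :> Q.

(** Division with remainder by the least positive element of [D]; if there is none, [D] is zero and
    [d = 0] serves. *)
Lemma int_ideal (D : set int) : D 0 -> (forall x y, D x -> D y -> D (x - y)) ->
  exists2 d, D d & forall n, D n -> exists q, n = q * d.
Proof.
move=> D0 DB.
have DN x : D x -> D (- x) by move=> Dx; rewrite -(add0r (- x)); apply: DB.
have Dabs x : D x -> D `|x|%N%:Z.
  move=> Dx; rewrite abszE; case: (ger0P x) => _ //; exact: DN.
have [[k [k0 Dk]]|h] := pselect (exists k : nat, (0 < k)%N /\ D k%:Z); last first.
  exists 0 => // n Dn; exists 0; rewrite mul0r; apply: contrapT => n0; apply: h.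
  by exists `|n|%N; split; [rewrite absz_gt0; apply/eqP|apply: Dabs].
have ex : exists k : nat, (0 < k)%N && `[< D k%:Z >].
  by exists k; rewrite k0; apply/asboolP.
case: (ex_minnP ex) => d /andP[d0 /asboolP Dd] dmin.
exists d%:Z => // n Dn; exists (n %/ d)%Z.
have DM (q : int) : D (q * d%:Z).
  have Dn' (m : nat) : D (m%:Z * d%:Z).
    elim: m => [|m IH]; first by rewrite mul0r.
    have -> : m.+1%:Z * d%:Z = m%:Z * d%:Z - - d%:Z by lia.
    by apply: DB => //; apply: DN.
  by case: q => m; rewrite ?NegzE ?mulNr; [|apply: DN]; apply: Dn'.
have d0z : d%:Z != 0 by rewrite eqz_nat -lt0n.
have hr : D (n %% d)%Z.
  have -> : (n %% d)%Z = n - (n %/ d)%Z * d by rewrite [X in _ = X - _](divz_eq n d) addrC addKr.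
  exact: DB.
have r0 := modz_ge0 n d0z; have rd := ltz_mod n d0z.
have [r00|r00] := eqVneq (n %% d)%Z 0; first by rewrite {1}(divz_eq n d) r00 addr0.
have := dmin `|(n %% d)%Z|%N; rewrite absz_gt0 r00 /=.
by move=> /(_ (asboolT (Dabs _ hr))); lia.
Qed.

(** Induction on generators. The coefficients along [a] of torsion elements form an ideal with
    generator [d]; subtracting a multiple of one torsion element [t] with coefficient [d] moves any
    torsion element into [span s]. *)
Lemma span_torsion_bounded s :
  exists2 M : nat, (0 < M)%N & forall x, span s x -> torsion x -> x *+ M = 0.
Proof.
elim: s => [|a s [M M0 hM]]; first by exists 1%N => // x ->; rewrite mul0rn.
pose D := [set n : int | exists2 y, span s y & torsion (a *~ n + y)].
have hS := subgroup_span s.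
have torB x y : torsion x -> torsion y -> torsion (x - y).
  move=> [k k0 hk] [m m0 hm]; exists (k * m)%N; first by rewrite muln_gt0 k0.
  by rewrite mulrnBl mulrnA hk mul0rn mulnC mulrnA hm mul0rn subr0.
have [] := @int_ideal D.
- exists 0; first exact: hS.1.
  by rewrite mulr0z addr0; exists 1%N.
- move=> n m [y hy ty] [z hz tz]; exists (y - z); first exact: hS.2.
  have -> : a *~ (n - m) + (y - z) = (a *~ n + y) - (a *~ m + z).
    by rewrite mulrzBr opprD addrACA.
  exact: torB.
move=> d [y0 hy0 [e e0 he]] hd; exists (e * M)%N; first by rewrite muln_gt0 e0.
move=> x [n [y hy xE]] tx.
have [q nE] : exists q, n = q * d by apply: hd; exists y; rewrite // -xE.
pose t := a *~ d + y0.
have tt : torsion t by exists e.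
have hz : span s (x - t *~ q).
  have -> : x - t *~ q = y - y0 *~ q.
    by rewrite xE nE mulrzDl -mulrzA [d * q]mulrC opprD addrACA subrr add0r.
  by apply: hS.2 => //; apply: subgroupMz.
have tz : torsion (x - t *~ q).
  apply: torB => //; exists e => //.
  by rewrite pmulrn -mulrzA mulrC mulrzA -pmulrn he mul0rz.
rewrite -(subrK (t *~ q) x) mulrnDl mulnC mulrnA hM // mul0rn add0r.
by rewrite mulnC mulrnA [X in X *+ M](_ : _ = 0) ?mul0rn //
  pmulrn -mulrzA mulrC mulrzA -pmulrn he mul0rz.
Qed.

Variant gen E (x : Q) : Prop :=
  Gen of forall G, subgroup G -> E `<=` G -> G x.

Lemma subgroup_gen E : subgroup (gen E).
Proof.
split=> [|x y [hx] [hy]]; split=> G hG EG; first exact: hG.1.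
by apply: hG.2; [apply: hx|apply: hy].
Qed.

Lemma sub_gen E : E `<=` gen E.
Proof. by move=> x Ex; split=> G _; apply. Qed.

Lemma gen_min E G : subgroup G -> E `<=` G -> gen E `<=` G.
Proof. by move=> hG EG x [hx]; apply: hx. Qed.

Lemma gen_sub E H : E `<=` H -> gen E `<=` gen H.
Proof. by move=> EH; apply: gen_min (subgroup_gen H) _ => x /EH; apply: sub_gen. Qed.

Lemma gen_comb E x : gen E x -> exists l (n : Q -> int),
  (forall y, y \in l -> E y) /\ x = \sum_(y <- l) y *~ n y.
Proof.
(* Duplicate-free lists let two combinations be extended by zero coefficients to a common list,
   where they can be subtracted termwise. *)
pose G := [set x | exists l (n : Q -> int), uniq l /\
  (forall y, y \in l -> E y) /\ x = \sum_(y <- l) y *~ n y].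
have comb_ext l l' (n : Q -> int) : uniq l -> uniq l' -> {subset l <= l'} ->
    \sum_(y <- l) y *~ n y = \sum_(y <- l') y *~ (if y \in l then n y else 0).
  move=> ul ul' ll'; rewrite [RHS](bigID (mem l)) /= [X in _ = _ + X]big1 ?addr0; last first.
    by move=> y /negPf ->; rewrite mulr0z.
  rewrite -[RHS]big_filter.
  rewrite [RHS](perm_big l); last first.
    apply: uniq_perm; rewrite ?filter_uniq // => y; rewrite mem_filter.
    by case: (boolP (y \in l)) => //= /ll'.
  by apply: eq_big_seq => y yl; rewrite /= yl.
suff hG : gen E `<=` G by move=> /hG [l [n [_ [h1 h2]]]]; exists l, n.
apply: gen_min; last first.
  move=> y Ey; exists [:: y], (fun=> 1); split=> //; split; last by rewrite big_seq1.
  by move=> z; rewrite inE => /eqP->.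
split; first by exists [::], (fun=> 0); rewrite big_nil.
move=> _ _ [l [n [ul [hl ->]]]] [l' [n' [ul' [hl' ->]]]].
exists (undup (l ++ l')), (fun y => (if y \in l then n y else 0) - (if y \in l' then n' y else 0)).
split; first exact: undup_uniq.
split; first by move=> y; rewrite mem_undup mem_cat => /orP[/hl|/hl'].
under [RHS]eq_bigr do rewrite mulrzBr.
rewrite sumrB -!comb_ext ?undup_uniq // => y; rewrite mem_undup mem_cat => ->;
  by rewrite ?orbT.
Qed.

Definition indep E := forall l, uniq l -> (forall y, y \in l -> E y) ->
  forall n : Q -> int, \sum_(y <- l) y *~ n y = 0 ->
  forall y, y \in l -> y *~ n y = 0.

Lemma indep_family E (I : eqType) (l : seq I) (f : I -> Q) (m : I -> int) :
  indep E -> uniq l -> {in l &, injective f} -> (forall i, i \in l -> E (f i)) ->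
  \sum_(i <- l) f i *~ m i = 0 -> forall i, i \in l -> f i *~ m i = 0.
Proof.
move=> hE ul finj fE s0 i il.
pose n y := m (nth i l (index y (map f l))).
have nE j : j \in l -> n (f j) = m j.
  move=> jl; rewrite /n; congr m; apply: finj => //.
    by rewrite mem_nth // -(size_map f) index_mem map_f.
  by rewrite -(nth_map i (f i)) ?nth_index ?map_f // -(size_map f) index_mem map_f.
rewrite -nE //; apply: (hE (map f l)).
- by rewrite map_inj_in_uniq.
- by move=> _ /mapP[j jl ->]; apply: fE.
- by rewrite big_map; apply: etrans s0; apply: eq_big_seq => j jl; rewrite nE.
- exact: map_f.
Qed.

Lemma indep_add E b : indep E ->
  (forall (n : int) y, gen E y -> b *~ n + y = 0 -> b *~ n = 0) ->
  indep (b |` E).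
Proof.
move=> hE hb l ul lE n.
have [bl|bl] := boolP (b \in l); last first.
  apply: hE => // y yl; case: (lE _ yl) => // yb.
  by move: bl; rewrite -yb yl.
have remE y : y \in rem b l -> E y.
  rewrite mem_rem_uniq // inE => /andP[/eqP yb /lE [|//]]; by move=> /yb.
rewrite (big_rem b) //= => s0 y yl.
have b0 : b *~ n b = 0.
  refine (hb _ _ _ s0); apply: subgroup_sum => [|z /remE Ez]; first exact: subgroup_gen.
  exact: subgroupMz (subgroup_gen E) (sub_gen Ez).
have [->//|yb] := eqVneq y b.
apply: (hE (rem b l)); rewrite ?rem_uniq //; last by rewrite mem_rem_uniq // inE yb.
by rewrite b0 add0r in s0.
Qed.

Definition cyclic_sum A := exists E, [/\ E `<=` A, indep E & A `<=` gen E].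

(** Induction on generators. If a positive multiple of [a] lies in [span s], some multiplication by
    [k] embeds [H] into [span s]. Otherwise the coefficient along [a] is well defined, and [H] is
    the sum of its part in [span s] and one infinite cyclic group, or lies in [span s]. *)
Lemma free_subgroup s : (forall x, span s x -> torsion x -> x = 0) ->
  forall H, subgroup H -> H `<=` span s -> cyclic_sum H.
Proof.
elim: s => [|a s IH] tf H hH Hs.
  exists set0; split=> //; last by move=> x /Hs ->; exact: (subgroup_gen _).1.
  by move=> l _ hl n _ y /hl.
have hS := subgroup_span s.
have sS x : span s x -> span (a :: s) x.
  by move=> hx; exists 0, x; rewrite // mulr0z add0r.
have {}IH := IH (fun x hx => tf x (sS x hx)).
have [[k [k0 hk]]|indp] := pselect (exists k : nat, (0 < k)%N /\ span s (a *+ k)).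
  have tfk x : span (a :: s) x -> x *+ k = 0 -> x = 0.
    by move=> hx xk; apply: tf => //; exists k.
  have [] := IH (mulset k H); first exact: subgroup_mulset.
    move=> _ [x /Hs [n [y hy ->]] <-]; rewrite mulrnDl; apply: subgroupD => //.
      by rewrite pmulrn -mulrzA mulrC mulrzA -pmulrn; apply: subgroupMz.
    exact: subgroupMn.
  (* Multiplication by [k] is injective on [H], so a basis of [k H] pulls back to one of [H]. *)
  move=> E [EH iE genE]; pose E' := [set y | H y /\ E (y *+ k)].
  have E'H : E' `<=` H by move=> y [].
  exists E'; split=> //.
    move=> l ul lE n s0 y yl; have [Hy _] := lE _ yl.
    apply: (tfk); first by apply: Hs; apply: subgroupMz.
    rewrite pmulrn -mulrzA mulrC mulrzA -pmulrn.
    apply: (indep_family (f := fun y => y *+ k) iE ul) => //.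
    - move=> u v ul' vl' e; apply/eqP; rewrite -subr_eq0; apply/eqP.
      apply: (tfk); last by rewrite mulrnBl e subrr.
      by apply: (subgroup_span _).2; apply: Hs; apply: E'H; apply: lE.
    - by move=> u /lE [].
    - transitivity ((\sum_(i <- l) i *~ n i) *+ k); last by rewrite s0 mul0rn.
      rewrite -sumrMnl; apply: eq_bigr => i _.
      by rewrite !pmulrn -!mulrzA mulrC.
  move=> x Hx.
  have : mulset k (gen E') (x *+ k).
    apply: (gen_min (E := E)); last by apply: genE; exists x.
      by apply: subgroup_mulset; apply: subgroup_gen.
    by move=> z Ez; have [y Hy yz] := EH _ Ez; exists y => //;
      apply: sub_gen; split; rewrite // yz.
  move=> [x' gx' e]; have Hx' : H x' by apply: gen_min E'H _ gx'.
  have -> : x = x'; last by [].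
  apply/eqP; rewrite -subr_eq0; apply/eqP; apply: (tfk).
    by apply: (subgroup_span _).2; apply: Hs.
  by rewrite mulrnBl e subrr.
have ind (n : int) : span s (a *~ n) -> n = 0.
  move=> hn; apply: contrapT => n0; apply: indp; exists `|n|%N; split.
    by rewrite absz_gt0; apply/eqP.
  case: n hn {n0} => n; rewrite ?NegzE ?mulrNz -?pmulrn ?abszN //= => hn.
  by rewrite -[X in span s X]opprK; apply: subgroupN.
(* The ideal of coefficients along [a] of elements of [H]; an element [b] realising its generator
   splits off. *)
pose D := [set n : int | exists2 y, span s y & H (a *~ n + y)].
have [] := @int_ideal D.
- by exists 0; [exact: hS.1|rewrite mulr0z addr0; exact: hH.1].
- move=> n m [y hy ty] [z hz tz]; exists (y - z); first exact: hS.2.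
  have -> : a *~ (n - m) + (y - z) = (a *~ n + y) - (a *~ m + z).
    by rewrite mulrzBr opprD addrACA.
  exact: hH.2.
move=> d [g0 hg0 Hb] hd; have [d0|d0] := eqVneq d 0.
  apply: IH => // x Hx; have [n [y hy xE]] := Hs _ Hx.
  have [q nE] : exists q, n = q * d by apply: hd; exists y; rewrite // -xE.
  by rewrite xE nE d0 mulr0 mulr0z add0r.
pose b := a *~ d + g0.
have [] := IH (H `&` span s).
- by split; [split; [exact: hH.1|exact: hS.1]|move=> x y [? ?] [? ?]; split;
    [exact: hH.2|exact: hS.2]].
- by move=> x [].
move=> E [EH iE genE]; exists (b |` E); split.
- by move=> x [->//|/EH []].
- apply: indep_add => // n y gy e.
  have sy : span s y by apply: gen_min gy => // x /EH[].
  suff -> : n = 0 by rewrite mulr0z.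
  have : span s (a *~ (d * n)).
    have -> : a *~ (d * n) = - (g0 *~ n + y).
      by apply/eqP; rewrite -addr_eq0 addrA -e /b mulrzDl mulrzA.
    by apply: subgroupN => //; apply: subgroupD => //; apply: subgroupMz.
  by move/ind/eqP; rewrite mulf_eq0 (negPf d0) /= => /eqP.
- move=> x Hx; have [n [y hy xE]] := Hs _ Hx.
  have [q nE] : exists q, n = q * d by apply: hd; exists y; rewrite // -xE.
  rewrite -(subrK (b *~ q) x); apply: subgroupD; first exact: subgroup_gen.
    apply: (gen_sub (E := E)); first by move=> ?; right.
    apply: genE; split; first by apply: hH.2 => //; apply: subgroupMz.
    have -> : x - b *~ q = y - g0 *~ q.
      by rewrite xE nE mulrzDl -mulrzA [d * q]mulrC opprD addrACA subrr add0r.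
    by apply: hS.2 => //; apply: subgroupMz.
  by apply: subgroupMz; [exact: subgroup_gen|apply: sub_gen; left].
Qed.

Lemma int_bezout (p : nat) (n : int) : prime p -> ~~ (p %| n)%Z ->
  exists u v : int, u * n + v * p = 1.
Proof.
move=> pp pn; have : coprimez n p.
  by rewrite /coprimez gcdzC -[_ == _]/(coprime p `|n|) prime_coprime.
by move=> /coprimezP [[u v] /= h]; exists u, v.
Qed.

(* Writing each generator of [p A] as [c = p a_c], with [a_c] a multiple of [c]
   whenever the order of [c] is prime to [p], keeps the [a_c] independent, and
   they generate [A] up to elements of order [p]: the missing ones are supplied
   by a maximal independent family. *)
Lemma cyclic_sum_of_prime_mul (p : nat) A : prime p -> subgroup A ->
  cyclic_sum (mulset p A) -> cyclic_sum A.
Proof.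
move=> pp hA [E [EA iE genE]].
have lift (c : Q) : exists a, E c ->
    [/\ A a, a *+ p = c & forall n : int, c *~ n = 0 -> a *~ n = 0 \/ (p %| n)%Z].
  have [Ec|nEc] := pselect (E c); last by exists 0.
  have [a Aa ac] := EA _ Ec.
  have [[n [cn pn]]|h] := pselect (exists n : int, c *~ n = 0 /\ ~~ (p %| n)%Z).
    have [u [v uv]] := int_bezout pp pn.
    (* Since [u n + v p = 1] and [n] kills [c], the multiple [v c] is a quotient of [c] by [p]
       inside the cyclic group of [c]. *)
    exists (c *~ v) => _; split.
    - by rewrite -ac; apply: subgroupMz => //; apply: subgroupMn.
    - rewrite pmulrn -mulrzA -[RHS]mulr1z -uv mulrzDr.
      by rewrite [u * n]mulrC [c *~ (n * u)]mulrzA cn mul0rz add0r.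
    - by move=> m cm; left; rewrite -mulrzA mulrC mulrzA cm mul0rz.
  exists a => _; split=> // n cn; right; apply: contrapT => /negP pn.
  by apply: h; exists n.
have [f hf] := choice lift; pose S := f @` E.
have SA : S `<=` A by move=> _ [c /hf [] ? _ _ <-].
have SE y : S y -> E (y *+ p) by move=> [c Ec <-]; have [_ -> _] := hf _ Ec.
have Sinj y z : S y -> S z -> y *+ p = z *+ p -> y = z.
  move=> [c Ec <-] [d Ed <-]; have [_ -> _] := hf _ Ec.
  by have [_ -> _] := hf _ Ed; move=> ->.
have Sord y (n : int) : S y -> (y *+ p) *~ n = 0 -> y *~ n = 0 \/ (p %| n)%Z.
  by move=> [c Ec <-]; have [_ -> ] := hf _ Ec; apply.
have iS : indep S.
  move=> l ul lS n s0.
  have key (m : Q -> int) : \sum_(y <- l) (y *+ p) *~ m y = 0 ->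
      forall y, y \in l -> (y *+ p) *~ m y = 0.
    apply: (indep_family iE ul); first by move=> u v /lS Su /lS Sv; apply: Sinj.
    by move=> y /lS; apply: SE.
  have h1 : forall y, y \in l -> (y *+ p) *~ n y = 0.
    apply: (key); transitivity ((\sum_(i <- l) i *~ n i) *+ p); last by rewrite s0 mul0rn.
    rewrite -sumrMnl; apply: eq_bigr => i _.
    by rewrite !pmulrn -!mulrzA mulrC.
  (* A nonzero term has a coefficient divisible by [p], hence is a multiple of [p y], an element of
     [E]; this turns the relation on [S] into one on [E]. *)
  pose m y : int := if `[< y *~ n y = 0 >] then 0 else (n y %/ p)%Z.
  have mE y : y \in l -> (y *+ p) *~ m y = y *~ n y.
    move=> yl; rewrite /m; case: asboolP => [->|h]; first by rewrite mulr0z.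
    have [//|pn] := Sord _ _ (lS _ yl) (h1 _ yl).
    by rewrite pmulrn -mulrzA mulrC divzK.
  move=> y yl; rewrite -mE //; apply: key => //.
  by apply: etrans s0; apply: eq_big_seq => z zl; rewrite mE.
(* Zorn's lemma applies to the families that stay independent together with [S]. *)
pose P (F : set Q) := F `<=` A /\ indep (F `|` S).
have [C CP Ctot|F [[FA iF] Fmax]] := @Zorn_bigcup Q P.
  split; first by move=> x [F CF Fx]; have [FA _] := CP _ CF; apply: FA.
  move=> l ul lC; have [F [PF lF]] : exists F, P F /\ forall y, y \in l -> (F `|` S) y.
    have : exists F, (C F \/ F = set0) /\ forall y, y \in l -> (F `|` S) y.
      elim: l lC {ul} => [|x l IH] lC; first by exists set0; split; [right|].
      have [|F [CF lF]] := IH.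
        by move=> y yl; apply: lC; rewrite in_cons yl orbT.
      have [[F' CF' F'x]|Sx] := lC x (mem_head _ _); last first.
        exists F; split=> // y; rewrite in_cons => /orP[/eqP->|/lF//]; by right.
      have [G [CG FG F'G]] : exists G, [/\ C G, F `<=` G & F' `<=` G].
        case: CF => [CF|->]; last by exists F'; split=> //; exact: sub0set.
        have [?|?] := Ctot _ _ CF CF'; [exists F'|exists F]; split=> //; exact: subset_refl.
      exists G; split; [by left|move=> y]; rewrite in_cons => /orP[/eqP->|/lF].
        by left; apply: F'G.
      by case; [left; apply: FG|right].
    move=> [F [CF lF]]; exists F; split=> //; case: CF => [/CP//|->].
    by split=> //; rewrite set0U.
  case: PF => _ iF; exact: iF.
exists (F `|` S); split=> //; first by move=> x [/FA|/SA].
move=> x Ax.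
have : mulset p (gen S) (x *+ p).
  apply: (gen_min (E := E)); last by apply: genE; exists x.
    by apply: subgroup_mulset; apply: subgroup_gen.
  move=> c Ec; exists (f c); first by apply: sub_gen; exists c.
  by have [] := hf _ Ec.
move=> [s gs e]; rewrite -(subrK s x); apply: subgroupD; first exact: subgroup_gen.
  (* The element [x - s] has order dividing [p]. If it were outside the generated group, no multiple
     by an integer prime to [p] could lie inside, so adjoining it would keep independence and
     contradict maximality. *)
  apply: contrapT => ngz; apply: (Fmax ((x - s) |` F)).
    split; first by move=> y Fy; right.
    move=> /(_ (x - s) (or_introl erefl)) Fz; apply: ngz; apply: sub_gen; by left.
  split.
    move=> y [->|/FA//]; apply: hA.2 => //; exact: gen_min SA _ gs.
  rewrite -setUA; apply: indep_add => // n y gy e0.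
  have pz : (x - s) *+ p = 0 by rewrite mulrnBl e subrr.
  have [/dvdzP[q ->]|pn] := boolP (p %| n)%Z.
    by rewrite mulrC mulrzA -pmulrn pz mul0rz.
  exfalso; apply: ngz; have [u [v uv]] := int_bezout pp pn.
  have -> : x - s = (- y) *~ u.
    rewrite -[x - s]mulr1z -uv mulrzDr [v * p]mulrC [_ *~ (_ * v)]mulrzA -pmulrn pz mul0rz addr0.
    by rewrite [u * n]mulrC mulrzA; congr (_ *~ _); apply/eqP; rewrite -addr_eq0 e0.
  by apply: subgroupMz; [|apply: subgroupN => //]; apply: subgroup_gen.
by apply: gen_sub gs => y; right.
Qed.

(** The prime factors of [K] are removed one at a time. *)
Lemma cyclic_sum_of_mul K A : (0 < K)%N -> subgroup A ->
  cyclic_sum (mulset K A) -> cyclic_sum A.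
Proof.
elim/ltn_ind: K A => K IH A K0 hA hK.
have [K1|K1] := leqP K 1.
  suff <- : mulset K A = A by [].
  have -> : K = 1%N by lia.
  by rewrite eqEsubset; split=> [_ [x Ax <-] //|x Ax]; exists x.
have pp := pdiv_prime K1; apply: (cyclic_sum_of_prime_mul pp) => //.
have KE : K = (pdiv K * (K %/ pdiv K))%N by rewrite mulnC divnK ?pdiv_dvd.
apply: (IH (K %/ pdiv K)%N).
- by rewrite ltn_Pdiv ?prime_gt1.
- by rewrite divn_gt0 ?pdiv_gt0 // dvdn_leq ?pdiv_dvd.
- exact: subgroup_mulset.
suff <- : mulset K A = mulset (K %/ pdiv K) (mulset (pdiv K) A) by [].
rewrite eqEsubset; split=> [_ [x Ax <-]|_ [_ [x Ax <-] <-]].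
  by exists (x *+ pdiv K); [exists x|rewrite -mulrnA -KE].
by exists x => //; rewrite [in LHS]KE mulrnA.
Qed.

(** If [M] kills the torsion of [span s], then [M] times [span s] is finitely generated and torsion
    free, and it contains [N M A]. *)
Theorem cyclic_sum_of_fg_mul N s A : (0 < N)%N -> subgroup A ->
  (forall x, A x -> span s (x *+ N)) ->
  cyclic_sum A /\
  exists2 M : nat, (0 < M)%N & forall x, A x -> torsion x -> x *+ M = 0.
Proof.
move=> N0 hA hN; have [M M0 hM] := span_torsion_bounded s; split; last first.
  exists (N * M)%N; first by rewrite muln_gt0 N0.
  move=> x Ax [k k0 xk]; rewrite mulrnA; apply: hM; first exact: hN.
  by exists k => //; rewrite -mulrnA mulnC mulrnA xk mul0rn.
have MN0 : (0 < N * M)%N by rewrite muln_gt0 N0.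
apply: (cyclic_sum_of_mul MN0) => //.
apply: (@free_subgroup [seq a *+ M | a <- s]).
- move=> _ /span_muln [x hx ->] [k k0 h]; apply: hM => //.
  by exists (M * k)%N; rewrite ?muln_gt0 ?M0 // mulrnA.
- exact: subgroup_mulset.
- by move=> _ [x Ax <-]; rewrite mulrnA; apply: span_mulnE; apply: hN.
Qed.

End Algebra.

(** * Meager relations on the Cantor space *)

Section Category.
Local Notation cantor := (nat -> bool).
Implicit Types (A B : set (cantor * cantor)) (u v : seq bool).

Definition prefixed (T : Type) (u : seq T) (a : nat -> T) :=
  mkseq a (size u) = u.

Lemma prefixed_cat (T : Type) (u w : seq T) a : prefixed (u ++ w) a -> prefixed u a.
Proof.
rewrite /prefixed size_cat /mkseq iotaD map_cat => /(congr1 (take (size u))).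
by rewrite !take_size_cat ?size_map ?size_iota.
Qed.

Lemma prefixed_nth (T : Type) (x0 : T) (u : seq T) a i :
  prefixed u a -> (i < size u)%N -> a i = nth x0 u i.
Proof. by move=> <-; rewrite size_mkseq => h; rewrite nth_mkseq. Qed.

Lemma prefixed_extend (T : Type) (u : seq T) a n :
  prefixed u a -> (size u <= n)%N -> exists w, mkseq a n = u ++ w.
Proof.
move=> ua h; exists (drop (size u) (mkseq a n)).
rewrite -{1}(cat_take_drop (size u) (mkseq a n)); congr (_ ++ _).
by rewrite /mkseq -map_take take_iota (minn_idPl h).
Qed.

Lemma prefixed_limit (T : Type) (f : nat -> seq T) :
  (forall j, exists w, f j.+1 = f j ++ w) -> (forall j, (j <= size (f j))%N) ->
  exists a, forall j, prefixed (f j) a.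
Proof.
move=> fS fsz.
have fD j k : exists w, f (j + k)%N = f j ++ w.
  elim: k => [|k [w hw]]; first by exists [::]; rewrite addn0 cats0.
  have [w' hw'] := fS (j + k)%N; exists (w ++ w').
  by rewrite addnS hw' hw catA.
(* The word [f 1] is nonempty, so [T] is inhabited; [x0] is only a default for [nth]. *)
have [[x0 _]|noT] := pselect (exists x0 : T, True); last first.
  by case: (f 1%N) (fsz 1%N) => // x0 l _; case: noT; exists x0.
exists (fun i => nth x0 (f i.+1) i) => j.
apply: (@eq_from_nth _ x0); rewrite size_mkseq // => i ij.
rewrite nth_mkseq //; have [w hw] := fD i.+1 j; have [w' hw'] := fD j i.+1.
have : nth x0 (f (i.+1 + j)%N) i = nth x0 (f (j + i.+1)%N) i by rewrite addnC.
by rewrite hw hw' !nth_cat ij fsz.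
Qed.

Definition box u v : set (cantor * cantor) :=
  [set x | prefixed u x.1 /\ prefixed v x.2].

Lemma box_cat u v u' v' : box (u ++ u') (v ++ v') `<=` box u v.
Proof. by move=> x [/prefixed_cat ? /prefixed_cat ?]. Qed.

Definition nowhere_dense A :=
  forall u v, exists u' v', A `&` box (u ++ u') (v ++ v') = set0.

Definition meager A := exists2 N : nat -> set (cantor * cantor),
  (forall i, nowhere_dense (N i)) & A `<=` \bigcup_i N i.

Lemma nowhere_dense0 : nowhere_dense set0.
Proof. by move=> u v; exists [::], [::]; rewrite set0I. Qed.

Lemma nowhere_denseU A B : nowhere_dense A -> nowhere_dense B ->
  nowhere_dense (A `|` B).
Proof.
move=> hA hB u v; have [u1 [v1 h1]] := hA u v.
have [u2 [v2 h2]] := hB (u ++ u1) (v ++ v1).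
exists (u1 ++ u2), (v1 ++ v2); rewrite !catA setIUl h2 setU0.
by rewrite -subset0 -h1; apply: setIS; apply: box_cat.
Qed.

Lemma meager_nowhere_dense A : nowhere_dense A -> meager A.
Proof. by move=> hA; exists (fun=> A) => // x Ax; exists 0%N. Qed.

Lemma meager_sub A B : A `<=` B -> meager B -> meager A.
Proof. by move=> AB [N hN BN]; exists N => //; apply: subset_trans BN. Qed.

Lemma meager_bigcup (T : countType) (F : T -> set (cantor * cantor)) :
  (forall t, meager (F t)) -> meager (\bigcup_t F t).
Proof.
move=> hF; have {}hF t : exists N : nat -> set (cantor * cantor),
    (forall i, nowhere_dense (N i)) /\ F t `<=` \bigcup_i N i.
  by have [N] := hF t; exists N.
have [G hG] := choice hF.
pose H (n : nat) := if unpickle n is Some (t, i) then G t i else set0.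
exists H; last first.
  move=> x [t _ /(hG t).2 [i _ Gx]]; exists (pickle (t, i)) => //.
  by rewrite /H pickleK.
move=> n; rewrite /H; case: unpickle => [[t i]|]; first exact: (hG t).1.
exact: nowhere_dense0.
Qed.

(** The pairs are treated one after another. Each treatment only lengthens words, so the boxes
    shrink and pairs already treated stay avoided. *)
Lemma avoid_pairs (M : set (cantor * cantor)) (P : seq (seq bool * seq bool))
    (U : seq bool -> seq bool) : nowhere_dense M ->
  exists W : seq bool -> seq bool, forall s t, (s, t) \in P -> s <> t ->
    M `&` box (U s ++ W s) (U t ++ W t) = set0.
Proof.
move=> hM; elim: P => [|[s t] P [W IH]]; first by exists (fun=> [::]).
have [-> |st] := eqVneq s t.
  by exists W => s' t'; rewrite in_cons => /orP[/eqP[-> ->]//|]; apply: IH.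
have [u' [v' h]] := hM (U s ++ W s) (U t ++ W t).
pose e x := if x == s then u' else if x == t then v' else [::].
exists (fun x => W x ++ e x) => s' t'; rewrite !catA in_cons => /orP[/eqP[-> ->] _|hP st'].
  by rewrite /e eqxx eq_sym (negPf st) eqxx.
by rewrite -subset0 -(IH _ _ hP st'); apply: setIS; apply: box_cat.
Qed.

(* Mycielski's theorem: the complement of a meager relation contains the square,
   minus the diagonal, of a perfect set. *)
Lemma mycielski A : meager A ->
  exists f : cantor -> cantor, forall a b, a <> b -> ~ A (f a, f b).
Proof.
move=> [N hN AN].
pose M j := \big[setU/set0]_(i < j.+1) N i.
have hM j : nowhere_dense (M j).
  rewrite /M; elim/big_ind: _ => //; [exact: nowhere_dense0|exact: nowhere_denseU].
(* One level of a tree of words indexed by finite binary sequences: boxes of distinct indices of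
   length [j + 1] avoid [M j], and the appended [true] makes the words grow. *)
have step (jU : nat * (seq bool -> seq bool)) : exists U' : seq bool -> seq bool,
    (forall s, exists w, U' s = rcons (jU.2 (take jU.1 s)) true ++ w) /\
    forall s t, size s = jU.1.+1 -> size t = jU.1.+1 -> s <> t ->
      M jU.1 `&` box (U' s) (U' t) = set0.
  case: jU => j U /=; pose P := [seq (tval s, tval t) | s <- enum {: j.+1.-tuple bool}, t <- enum {: j.+1.-tuple bool}].
  have [W hW] := avoid_pairs P (fun s => rcons (U (take j s)) true) (hM j).
  exists (fun s => rcons (U (take j s)) true ++ W s); split; first by move=> s; exists (W s).
  move=> s t /eqP ss /eqP tt; apply: hW; apply/allpairsP.
  by exists (Tuple ss, Tuple tt); rewrite !mem_enum.
have [F hF] := choice step.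
pose V := fix V j := if j is j'.+1 then F (j', V j') else fun=> [::].
have Vsz j s : (j <= size (V j s))%N.
  elim: j s => //= j IH s; have [w ->] := (hF (j, V j)).1 s.
  by rewrite size_cat size_rcons /=; apply: ltn_addr; rewrite ltnS.
have hf a : exists fa, forall j, prefixed (V j (mkseq a j)) fa.
  apply: prefixed_limit => // j /=; have [w ->] := (hF (j, V j)).1 (mkseq a j.+1).
  exists (true :: w); rewrite -cat_rcons /=; congr (rcons (V j _) _ ++ _).
  by rewrite /mkseq -map_take take_iota (minn_idPl (leqnSn j)).
have [f {}hf] := choice hf.
exists f => a b ab /AN [n _ Nn].
have [i hi] : exists i, a i <> b i.
  by apply: contrapT => h; apply: ab; apply/funext => i; apply: contrapT => hi; apply: h; exists i.
(* At level [j + 1] the prefixes of [a] and [b] already differ, and [M j] already contains [N n]. *)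
pose j := maxn n i.
have : (M j `&` box (V j.+1 (mkseq a j.+1)) (V j.+1 (mkseq b j.+1))) (f a, f b).
  split; last by split; apply: hf.
  rewrite /M -bigcup_mkord; exists n => //=; exact: leq_maxl.
suff -> : M j `&` box (V j.+1 (mkseq a j.+1)) (V j.+1 (mkseq b j.+1)) = set0 by [].
apply: (hF (j, V j)).2; rewrite ?size_mkseq // => /(congr1 (fun s => nth false s i)).
by rewrite !nth_mkseq ?ltnS ?leq_maxr.
Qed.

Definition everywhere_nonmeager B u v :=
  forall u' v', ~ meager (B `&` box (u ++ u') (v ++ v')).

Lemma everywhere_nonmeager_cat B u v u' v' : everywhere_nonmeager B u v ->
  everywhere_nonmeager B (u ++ u') (v ++ v').
Proof. by move=> h u2 v2; rewrite -!catA; apply: h. Qed.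

Lemma everywhere_nonmeager_ex B u v : everywhere_nonmeager B u v ->
  B `&` box u v !=set0.
Proof.
move=> h; apply/set0P/eqP => e; apply: (h [::] [::]).
by rewrite !cats0 e; apply: meager_nowhere_dense; apply: nowhere_dense0.
Qed.

(** Otherwise the boxes on which [B] is meager are dense in [box u v]. There are countably many
    boxes, so [B] is meager on their union, and the remainder [R] of [box u v] is nowhere dense. *)
Lemma nonmeager_localize B u v : ~ meager (B `&` box u v) ->
  exists u' v', everywhere_nonmeager B (u ++ u') (v ++ v').
Proof.
move=> nm; apply: contrapT => no; apply: nm.
have dens u' v' : exists u2 v2, meager (B `&` box (u ++ u' ++ u2) (v ++ v' ++ v2)).
  apply: contrapT => h; apply: no; exists u', v' => u2 v2 hm; apply: h.
  by exists u2, v2; rewrite !catA.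
pose G := [set p : seq bool * seq bool | meager (B `&` box p.1 p.2)].
pose R := [set x | box u v x /\ forall p, G p -> ~ box p.1 p.2 x].
pose F (p : option (seq bool * seq bool)) : set (cantor * cantor) :=
  if p is Some p then [set x | G p /\ (B `&` box p.1 p.2) x] else R.
apply: (@meager_sub _ (\bigcup_p F p)).
  move=> x [Bx bx]; have [[p [Gp px]]|h] := pselect (exists p, G p /\ box p.1 p.2 x).
    by exists (Some p).
  by exists None => //; split=> // p Gp px; apply: h; exists p.
apply: meager_bigcup => -[p|] /=.
  have [Gp|nG] := pselect (G p).
    by apply: meager_sub Gp => x [].
  by apply: meager_sub (meager_nowhere_dense nowhere_dense0) => x [].
apply: meager_nowhere_dense => p q.
have [[x [[px qx] [ux vx]]]|h] := pselect (exists x, box p q x /\ box u v x); last first.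
  exists [::], [::]; rewrite !cats0; rewrite -subset0 => x [[bx _] bx'].
  by apply: h; exists x.
(* Prefixes of [x] of length [L] extend both the given box and [box u v], so density inside
   [box u v] applies below them. *)
pose L := maxn (maxn (size p) (size q)) (maxn (size u) (size v)).
have [|p1 hp1] := @prefixed_extend _ p x.1 L px; first by rewrite /L; lia.
have [|q1 hq1] := @prefixed_extend _ q x.2 L qx; first by rewrite /L; lia.
have [|u1 hu1] := @prefixed_extend _ u x.1 L ux; first by rewrite /L; lia.
have [|v1 hv1] := @prefixed_extend _ v x.2 L vx; first by rewrite /L; lia.
have [u2 [v2 hm]] := dens u1 v1.
exists (p1 ++ u2), (q1 ++ v2); rewrite !catA -hp1 -hq1 hu1 hv1 -!catA.
by rewrite -subset0 => y [[_ /(_ (_, _) hm) h]].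
Qed.

(** * Fusion for projections of closed sets *)

Section Fusion.
Variable W : (nat -> nat) -> set (cantor * cantor).

Hypothesis W_closed : forall M x,
  (forall j, exists M' x', [/\ forall i, (i < j)%N ->
     [/\ M' i = M i, x'.1 i = x.1 i & x'.2 i = x.2 i] & W M' x']) -> W M x.

(** [W_closed] says that [W] is a closed set of pairs of a witness and a point. [A [::]] is its
    projection, an analytic set; [A s] is the part with witnesses starting with [s]. *)
Let A (s : seq nat) := [set x | exists2 M, prefixed s M & W M x].

(** [A s] is the countable union of the sets [A (rcons s i)], so one of them is not meager on the
    box and can be localized. *)
Let everywhere_nonmeager_step s u v : everywhere_nonmeager (A s) u v ->
  exists i u' v', everywhere_nonmeager (A (rcons s i)) (u ++ u') (v ++ v').
Proof.
move=> h.
have [i hi] : exists i, ~ meager (A (rcons s i) `&` box u v).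
  apply: contrapT => no; apply: (h [::] [::]); rewrite !cats0.
  apply: (@meager_sub _ (\bigcup_i (A (rcons s i) `&` box u v))).
    move=> x [[M sM Wx] bx]; exists (M (size s)) => //; split=> //; exists M => //.
    rewrite /prefixed size_rcons /mkseq -addn1 iotaD map_cat /= add0n cats1.
    by congr rcons.
  by apply: meager_bigcup => i; apply: contrapT => hi; apply: no; exists i.
by have [u' [v' h']] := nonmeager_localize hi; exists i, u', v'.
Qed.

(** The state of a double construction: the first coordinates have stems [c] and [c'] and a common
    tail [t], the second coordinate [v] is shared, and the witnesses [s] and [s'] are
    independent. *)
Let good (c : seq bool) (c' : seq bool) (x : seq bool * seq bool * seq nat * seq nat) :=
  let: (t, v, s, s') := x in
  everywhere_nonmeager (A s) (c ++ t) v /\ everywhere_nonmeager (A s') (c' ++ t) v.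

(** The extension found for the first point is imposed on the second before that one is refined, and
    the refinement is then imposed back on the first. The inserted [false] makes the words grow. *)
Let good_step c c' x : exists y, good c c' x -> good c c' y /\
  let: (t, v, s, s') := x in let: (t2, v2, s2, s2') := y in
  exists t1 v1 i i', [/\ t2 = t ++ false :: t1, v2 = v ++ false :: v1,
     s2 = rcons s i & s2' = rcons s' i'].
Proof.
case: x => [[[t v] s] s'] /=.
have [[h h']|] := pselect (everywhere_nonmeager (A s) (c ++ t) v /\
  everywhere_nonmeager (A s') (c' ++ t) v); last by exists (t, v, s, s').
have [i [u1 [v1 h1]]] := everywhere_nonmeager_step
  (@everywhere_nonmeager_cat _ _ _ [:: false] [:: false] h).
have [i' [u2 [v2 h2]]] := everywhere_nonmeager_step
  (@everywhere_nonmeager_cat _ _ _ (false :: u1) (false :: v1) h').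
exists (t ++ false :: u1 ++ u2, v ++ false :: v1 ++ v2, rcons s i, rcons s' i').
move=> _; split; last by exists (u1 ++ u2), (v1 ++ v2), i, i'.
split.
  move: (@everywhere_nonmeager_cat _ _ _ u2 v2 h1).
  by rewrite -!catA /= -?catA.
by move: h2; rewrite -!catA /= -?catA.
Qed.

(* An analytic set that is not meager is, on some box, so large that two points
   of it can be built simultaneously that differ in a single coordinate. *)
Lemma analytic_nonmeager_flip n : ~ meager (A [::]) ->
  exists k a a' b, [/\ (n <= k)%N, (forall i, i != k -> a i = a' i),
    a k <> a' k, A [::] (a, b) & A [::] (a', b)].
Proof.
move=> nm.
have [|u1 [v1 h1]] := @nonmeager_localize (A [::]) [::] [::].
  by move=> hm; apply: nm; apply: meager_sub hm => x Ax; split.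
(* The padding by [n] digits puts the coordinate that differs, [size c], at or beyond [n]. *)
pose c := u1 ++ nseq n false; pose c0 := rcons c false; pose c1 := rcons c true.
have g0 : good c0 c1 ([::], v1, [::], [::]).
  rewrite /good !cats0; split; rewrite /c0 /c1 /c -cats1 -catA -[v1]cats0;
  exact: everywhere_nonmeager_cat.
have [next hnext] := choice (good_step c0 c1).
pose X j := iter j next ([::], v1, [::], [::]).
have gX j : good c0 c1 (X j) by elim: j => //= j /hnext [].
pose T j := (X j).1.1.1; pose V j := (X j).1.1.2.
pose S j := (X j).1.2; pose S' j := (X j).2.
have XS j : exists t1 v1 i i', [/\ T j.+1 = T j ++ false :: t1,
    V j.+1 = V j ++ false :: v1, S j.+1 = rcons (S j) i & S' j.+1 = rcons (S' j) i'].
  rewrite /T /V /S /S' /=; have [_] := hnext _ (gX j); move: (X j) (next _).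
  by move=> [[[? ?] ?] ?] [[[? ?] ?] ?].
have szs j : [/\ (j <= size (T j))%N, (j <= size (V j))%N,
    (j <= size (S j))%N & (j <= size (S' j))%N].
  elim: j => // j [? ? ? ?]; have [t1 [v2 [i [i' [-> -> -> ->]]]]] := XS j.
  by rewrite !size_cat !size_rcons /= !addnS; split; lia.
have gX' j : everywhere_nonmeager (A (S j)) (c0 ++ T j) (V j) /\
    everywhere_nonmeager (A (S' j)) (c1 ++ T j) (V j).
  by have := gX j; rewrite /T /V /S /S'; case: (X j) => [[[? ?] ?] ?].
have [||t ht] := @prefixed_limit _ T.
- by move=> j; have [t1 [? [? [? [-> _ _ _]]]]] := XS j; exists (false :: t1).
- by move=> j; have [] := szs j.
have [||b hb] := @prefixed_limit _ V.
- by move=> j; have [? [t1 [? [? [_ -> _ _]]]]] := XS j; exists (false :: t1).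
- by move=> j; have [] := szs j.
have [||M hM] := @prefixed_limit _ S.
- by move=> j; have [? [? [i [? [_ _ -> _]]]]] := XS j; exists [:: i]; rewrite cats1.
- by move=> j; have [] := szs j.
have [||M' hM'] := @prefixed_limit _ S'.
- by move=> j; have [? [? [? [i [_ _ _ ->]]]]] := XS j; exists [:: i]; rewrite cats1.
- by move=> j; have [] := szs j.
pose a e i := if (i < size c)%N then nth false c i else
  if i == size c then e else t (i - (size c).+1)%N.
have ha e j i y : (i < j)%N -> prefixed (rcons c e ++ T j) y -> y i = a e i.
  move=> ij hy; have [hT _ _ _] := szs j.
  rewrite (prefixed_nth false hy); last by rewrite size_cat size_rcons; lia.
  rewrite /a nth_cat size_rcons nth_rcons ltnS leq_eqVlt.
  have [ic|ic|->] := ltngtP i (size c); rewrite //= (prefixed_nth false (ht j)) //; lia.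
(* Each box of the construction meets [A (s j)]; the members of [W] so obtained converge to the
   limit point and its witness, and closedness applies. *)
have lim e s N : (forall j, prefixed (s j) N) -> (forall j, (j <= size (s j))%N) ->
    (forall j, everywhere_nonmeager (A (s j)) (rcons c e ++ T j) (V j)) ->
    A [::] (a e, b).
  move=> hN hs hs'; exists N => //; apply: W_closed => j.
  have [x [[N' hN' Wx] [px1 px2]]] := everywhere_nonmeager_ex (hs' j).
  exists N', x; split=> // i ij; have [_ hV _ _] := szs j; split.
  - by rewrite (prefixed_nth 0%N hN' (leq_trans ij (hs j))) (prefixed_nth 0%N (hN j) (leq_trans ij (hs j))).
  - exact: ha ij px1.
  - by rewrite /= (prefixed_nth false px2 (leq_trans ij hV)) (prefixed_nth false (hb j) (leq_trans ij hV)).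
exists (size c), (a false), (a true), b; split.
- by rewrite size_cat size_nseq leq_addl.
- by move=> i /negPf ic; rewrite /a ic.
- by rewrite /a ltnn eqxx.
- by apply: (lim _ S M) => // j; [have [] := szs j|have [] := gX' j].
- by apply: (lim _ S' M') => // j; [have [] := szs j|have [] := gX' j].
Qed.

End Fusion.
End Category.

(** * Homology classes of paths *)

Lemma zmod_quotient (V : zmodType) (B : set V) : subgroup B ->
  exists (Q : zmodType) (p : {additive V -> Q}), forall x, p x = 0 <-> B x.
Proof.
move=> hB; pose S : pred V := fun x => `[< B x >].
have hS : zmod_closed S.
  split; first by apply/asboolP; exact: hB.1.
  by move=> x y /asboolP Bx /asboolP By; apply/asboolP; apply: hB.2.
pose I : zmodClosed V := HB.pack S (GRing.isZmodClosed.Build V S hS).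
have key x : (x \in I) = (x == 0 %[mod Quotient.quot I])%qT.
  by rewrite -Quotient.idealrBE subr0.
exists (Quotient.quot I), \pi_(Quotient.quot I)%qT => x; split=> h.
  by apply/asboolP; rewrite -[asbool _]/(x \in I) key h raddf0.
have : x \in I by apply/asboolP.
by rewrite key => /eqP e; apply: etrans e (raddf0 _).
Qed.

(** * Formal chains and their coefficients *)

Section Chains.
Variable S : eqType.
Implicit Types c d : chain S.

Lemma coef_cat c d : coef (c ++ d) = coef c + coef d :> (S -> int).
Proof. by apply/funext => s; rewrite /coef big_cat. Qed.

Lemma coef_scale n c : coef (cscale n c) = coef c *~ n :> (S -> int).
Proof.
apply/funext => s; rewrite /coef big_map /= -mulr_sumr.
have fctMn (f : S -> int) m : (f *+ m) s = f s *+ m.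
  by elim: m => // m IH; rewrite !mulrS -IH.
case: n => n; rewrite ?NegzE ?mulrNz -!pmulrn ?mulNr.
  by rewrite fctMn mulrC -mulrzz -pmulrn.
by rewrite [RHS]/(- ((coef c *+ n.+1) s)) fctMn mulrC -mulrzz -pmulrn.
Qed.

(** Grouping the terms by simplex, the additive extension of [f] to chains sees only
    coefficients. *)
Lemma sum_coef0 (Q : zmodType) (f : S -> Q) c : (forall s, coef c s = 0) ->
  \sum_(q <- c) f q.2 *~ q.1 = 0.
Proof.
move=> c0; pose r := undup [seq q.2 | q <- c].
have -> : \sum_(q <- c) f q.2 *~ q.1 =
    \sum_(q <- c) \sum_(s <- r | q.2 == s) f s *~ q.1.
  apply: eq_big_seq => q qc.
  rewrite (big_rem q.2) ?mem_undup ?map_f //= eqxx big_seq_cond big1 ?addr0 //.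
  by move=> s; rewrite mem_rem_uniq ?undup_uniq // inE => /andP[/andP[/negPf]];
    rewrite eq_sym => ->.
rewrite (exchange_big_dep predT) //= big1 // => s _.
by rewrite -mulrz_sumr -[X in _ *~ X]/(coef c s) c0 mulr0z.
Qed.

End Chains.

Definition cmap (S T : Type) (f : S -> T) (c : chain S) : chain T :=
  [seq (q.1, f q.2) | q <- c].

Lemma coef_cmap0 (S T : eqType) (f : S -> T) (c : chain S) :
  (forall s, coef c s = 0) -> forall t, coef (cmap f c) t = 0.
Proof.
move=> c0 t; rewrite /coef big_map /= big_mkcond /=.
apply: etrans (sum_coef0 (fun s => ((f s == t)%:R : int)) c0).
by apply: eq_bigr => q _; case: eqP => _; rewrite ?mul0rz ?intz.
Qed.

(* A chain vanishes because of a pattern of coincidences between its simplices;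
   the pattern is recorded as a vanishing chain of labels. *)
Lemma coef0_cmap (T : eqType) (t0 : T) (c : chain T) : (forall t, coef c t = 0) ->
  exists (d : chain nat) (v : nat -> T), (forall i, coef d i = 0) /\ c = cmap v d.
Proof.
move=> c0; pose l := [seq q.2 | q <- c].
exists (cmap (index^~ l) c), (nth t0 l); split.
  exact: coef_cmap0.
rewrite /cmap -map_comp -[LHS]map_id; apply/eq_in_map => -[n t] qc /=.
by rewrite nth_index //; apply/mapP; exists (n, t).
Qed.

Section RealLimits.
Variables (T : topologicalType) (f g : T -> RR).
Hypotheses (cf : continuous f) (cg : continuous g).

Lemma real_continuousD : continuous (fun x => f x + g x).
Proof. by move=> x; apply: (@cvgD RR RR^o _ (nbhs x)); [exact: cf|exact: cg]. Qed.

Lemma real_continuousB : continuous (fun x => f x - g x).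
Proof. by move=> x; apply: (@cvgB RR RR^o _ (nbhs x)); [exact: cf|exact: cg]. Qed.

Lemma real_continuousM : continuous (fun x => f x * g x).
Proof. by move=> x; apply: (@cvgM RR _ (nbhs x)); [exact: cf|exact: cg]. Qed.

Lemma real_continuous_affine a b : continuous (fun x => a + b * f x).
Proof.
move=> x; apply: (@cvgD RR RR^o _ (nbhs x)); first exact: cvg_cst.
by apply: (@cvgM RR _ (nbhs x)); [exact: cvg_cst|exact: cf].
Qed.

End RealLimits.

(** * Classes of 1-chains and calculus of paths *)

Section Classes.
Variable X : topologicalType.

Lemma bd2_cat (c d : chain (sing2 X)) : bd2 (c ++ d) = bd2 c ++ bd2 d.
Proof. by rewrite /bd2 map_cat flatten_cat. Qed.

Lemma bd2_scale n (c : chain (sing2 X)) : bd2 (cscale n c) = cscale n (bd2 c).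
Proof.
rewrite /bd2 /cscale map_flatten -!map_comp; congr flatten.
by apply: eq_map => q /=; rewrite mulrN.
Qed.

Lemma boundary1_subgroup :
  subgroup [set f : sing1 X -> int | exists2 z, boundary1 z & f = coef z].
Proof.
split.
  exists [::]; last by apply/funext => s; rewrite /coef big_nil.
  by exists [::]; split=> //; exists [::].
move=> _ _ [z [w [hw zw]] ->] [z' [w' [hw' zw']] ->].
exists (z ++ cscale (-1) z'); last by rewrite coef_cat coef_scale mulrN1z.
exists (w ++ cscale (-1) w'); split.
  by move=> q; rewrite mem_cat => /orP[/hw//|/mapP[q' /hw' h ->]].
move=> s; rewrite bd2_cat bd2_scale !coef_cat !coef_scale.
by rewrite (funext zw) (funext zw').
Qed.

(** Integer functions on 1-simplices modulo boundaries. The classes of cycles form a copy of [H_1],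
    and single paths that are not closed have classes too. *)
Lemma H1_quotient : exists (Q : zmodType) (p : {additive (sing1 X -> int) -> Q}),
  forall z : chain (sing1 X), p (coef z) = 0 <-> boundary1 z.
Proof.
have [Q [p hp]] := zmod_quotient boundary1_subgroup.
exists Q, p => z; rewrite hp; split; last by move=> h; exists z.
move=> [z' [w [hw zw]] e]; exists w; split=> // s.
by rewrite e zw.
Qed.

Variables (Q : zmodType) (p : {additive (sing1 X -> int) -> Q}).
Hypothesis p0 : forall z : chain (sing1 X), p (coef z) = 0 <-> boundary1 z.

Definition hclass (z : chain (sing1 X)) := p (coef z).
Definition sclass (f : sing1 X) := hclass [:: (1, f)].

Lemma hclass_cat c d : hclass (c ++ d) = hclass c + hclass d.
Proof. by rewrite /hclass coef_cat raddfD. Qed.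

Lemma hclass_scale n c : hclass (cscale n c) = hclass c *~ n.
Proof. by rewrite /hclass coef_scale raddfMz. Qed.

Lemma hclass_nil : hclass [::] = 0.
Proof. by apply/p0; exists [::]; split. Qed.

Lemma hclass_sum z : hclass z = \sum_(q <- z) sclass q.2 *~ q.1.
Proof.
elim: z => [|[n f] z IH]; first by rewrite big_nil hclass_nil.
rewrite big_cons -IH -cat1s hclass_cat -hclass_scale; congr (_ + _).
by rewrite /hclass /cscale /= mulr1.
Qed.

Lemma hclass_csub c d : hclass (csub c d) = hclass c - hclass d.
Proof. by rewrite /csub hclass_cat hclass_scale mulrN1z. Qed.

Lemma hclass_homologous c d : homologous c d <-> hclass c = hclass d.
Proof.
rewrite /homologous -p0 -/(hclass _) hclass_csub.
by split=> [/eqP|->]; rewrite ?subrr // subr_eq0 => /eqP.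
Qed.

Lemma hclass_comb (I : Type) (g : I -> chain (sing1 X)) l n :
  hclass (comb g l n) = \sum_(i <- l) hclass (g i) *~ n i.
Proof.
elim: l => [|i l IH]; first by rewrite big_nil hclass_nil.
by rewrite big_cons -IH -hclass_scale -hclass_cat.
Qed.

Lemma sclass_face (s : sing2 X) : continuous s ->
  sclass (s \o face0) + sclass (s \o face2) = sclass (s \o face1).
Proof.
move=> cs; apply/eqP; rewrite -subr_eq0; apply/eqP.
have : hclass (bd2 [:: (1, s)]) = 0.
  apply/p0; exists [:: (1, s)]; split=> //.
  by move=> q; rewrite inE => /eqP->.
rewrite hclass_sum /bd2 /= !big_cons big_nil /= mulrN1z !mulr1z addr0.
by rewrite addrA addrAC.
Qed.

(** Retraction of the line onto the unit interval: it extends paths to the whole line, where they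
    can be cut at arbitrary reals. *)
Definition clamp_val (t : RR) : RR := Num.min (Num.max t 0) 1.

Lemma clamp_in t : clamp_val t \in (`[0, 1]%classic : set RR).
Proof.
apply/mem_set; rewrite /= in_itv /= /clamp_val.
by rewrite le_min ler01 le_max lexx orbT /= ge_min lexx orbT.
Qed.

Definition clamp (t : RR) : Delta1 := SigSub (clamp_in t).

Lemma clampK (t : Delta1) : clamp (val t) = t.
Proof.
apply: val_inj; rewrite /= /clamp_val; have [h0 h1] := Delta1_bounds t.
by rewrite max_l // min_l.
Qed.

Lemma clamp0 (t : RR) : t <= 0 -> clamp t = d1zero.
Proof. by move=> t0; apply: val_inj; rewrite /= /clamp_val max_r // min_l. Qed.

Lemma clamp1 (t : RR) : 1 <= t -> clamp t = d1one.
Proof.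
by move=> t1; apply: val_inj; rewrite /= /clamp_val max_l ?min_r // (le_trans ler01).
Qed.

Lemma continuous_clamp : continuous clamp.
Proof.
apply: continuous_comp_initial => t /=.
apply: (@continuous_min _ _ (fun t : RR => Num.max t 0) (cst 1)); last exact: cvg_cst.
by apply: (@continuous_max _ _ (fun t : RR => t) (cst 0)); [exact: cvg_id|exact: cvg_cst].
Qed.

Lemma continuous_val1 : continuous (val : Delta1 -> RR).
Proof. exact: initial_continuous. Qed.

Lemma continuous_val2 : continuous (val : Delta2 -> RR * RR).
Proof. exact: initial_continuous. Qed.

Definition seg (F : RR -> X) (a b : RR) : sing1 X :=
  fun t => F (a + (b - a) * val t).

(** The three segments are the faces of the singular triangle [F \o r], where [r] is affine with
    values [a], [b], [c] at the vertices. No order of [a], [b], [c] is assumed, so constant and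
    reversed paths are covered. *)
Lemma seg_add F a b c : continuous F ->
  sclass (seg F a b) + sclass (seg F b c) = sclass (seg F a c).
Proof.
move=> cF.
pose r (x : Delta2) : RR := a + (b - a) * (val x).1 + (c - a) * (val x).2.
have cr : continuous r.
  have c1 : continuous (fun y : Delta2 => (val y).1).
    move=> x; have := @continuous_comp _ _ _ _ fst x (@continuous_val2 x).
    by apply; exact: cvg_fst.
  have c2 : continuous (fun y : Delta2 => (val y).2).
    move=> x; have := @continuous_comp _ _ _ _ snd x (@continuous_val2 x).
    by apply; exact: cvg_snd.
  have c3 : continuous (fun y : Delta2 => a + (b - a) * (val y).1).
    exact: real_continuous_affine.
  have c4 : continuous (fun y : Delta2 => (c - a) * (val y).2).
    by apply: real_continuousM; [exact: cst_continuous|exact: c2].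
  exact: (real_continuousD c3 c4).
pose s : sing2 X := F \o r.
have cs : continuous s by move=> x; apply: continuous_comp; [exact: cr|exact: cF].
have := sclass_face cs; rewrite addrC => h.
have -> : seg F a b = s \o face2.
  by apply/funext => t; rewrite /seg /s /r /=; congr F; ring.
have -> : seg F b c = s \o face0.
  by apply/funext => t; rewrite /seg /s /r /=; congr F; ring.
rewrite h; congr sclass.
by apply/funext => t; rewrite /seg /s /r /=; congr F; ring.
Qed.

Lemma seg_refl F a : continuous F -> sclass (seg F a a) = 0.
Proof. by move=> /(seg_add a a a) /eqP; rewrite -subr_eq0 addrK => /eqP. Qed.

Lemma seg_sym F a b : continuous F -> sclass (seg F b a) = - sclass (seg F a b).
Proof.
by move=> cF; apply/eqP; rewrite -addr_eq0 seg_add // seg_refl.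
Qed.

Lemma continuous_seg F a b : continuous F -> continuous (seg F a b).
Proof.
move=> cF t; apply: continuous_comp; last exact: cF.
exact: (real_continuous_affine continuous_val1).
Qed.

Lemma seg_clamp (f : sing1 X) : seg (f \o clamp) 0 1 = f.
Proof. by apply/funext => t; rewrite /seg /= subr0 mul1r add0r clampK. Qed.

Lemma continuous_glue (F G : RR -> X) (c : RR) : continuous F -> continuous G ->
  F c = G c -> continuous (fun t => if t <= c then F t else G t).
Proof.
move=> cF cG e t U hU; change (nbhs t [set s | U (if s <= c then F s else G s)]).
move: hU; case: (ltgtP t c) => [tc|ct|->] hU.
- have h1 : nbhs t (F @^-1` U) by apply: cF.
  by apply: filterS (filterI (lt_nbhsl tc) h1) => s [/= sc Us]; rewrite (ltW sc).
- have h1 : nbhs t (G @^-1` U) by apply: cG.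
  by apply: filterS (filterI (lt_nbhsr ct) h1) => s [/= sc Us]; rewrite leNgt sc.
- have h1 : nbhs c (F @^-1` U) by apply: cF.
  have h2 : nbhs c (G @^-1` U) by apply: cG; rewrite -e.
  by apply: filterS (filterI h1 h2) => s [/= Fs Gs]; case: ifP.
Qed.

Definition path_in (A : set X) (x y : X) (f : sing1 X) :=
  [/\ continuous f, f d1zero = x, f d1one = y & forall t, A (f t)].

Lemma path_in_sub A B x y f : A `<=` B -> path_in A x y f -> path_in B x y f.
Proof. by move=> AB [? ? ? h]; split=> // t; apply: AB. Qed.

Lemma continuous_clamped (f : sing1 X) : continuous f -> continuous (f \o clamp).
Proof. by move=> cf t; apply: continuous_comp; [exact: continuous_clamp|exact: cf]. Qed.

Lemma path_cat A x y z f g : path_in A x y f -> path_in A y z g ->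
  exists2 h, path_in A x z h & sclass h = sclass f + sclass g.
Proof.
move=> [cf f0 f1 fA] [cg g0 g1 gA].
pose G t := if t <= 1 then f (clamp t) else g (clamp (t - 1)).
have cG : continuous G.
  apply: (@continuous_glue (f \o clamp) (g \o clamp \o (fun t => t - 1))).
  - exact: continuous_clamped.
  - move=> t; apply: continuous_comp; last exact: continuous_clamped.
    by apply: real_continuousB => u; [exact: cvg_id|exact: cvg_cst].
  - by rewrite /= subrr clamp1 // clamp0 // f1 g0.
exists (seg G 0 2).
  split; first exact: continuous_seg.
  - by rewrite /seg mulr0 addr0 /G ler01 clamp0.
  - rewrite /seg /= mulr1 add0r subr0 /G ifF ?clamp1 //; first by lra.
    by apply/negbTE; rewrite -ltNge; lra.
  - by move=> t; rewrite /seg /G; case: ifP.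
rewrite -(seg_add 0 1 2 cG); congr (sclass _ + sclass _).
  apply/funext => t; rewrite /seg /G subr0 mul1r add0r.
  by have [_ ->] := Delta1_bounds t; rewrite clampK.
apply/funext => t; rewrite /seg /G; have [t0 t1] := Delta1_bounds t.
have -> : 1 + (2 - 1) * val t = 1 + val t :> RR by lra.
case: ifP => h; last by congr g; rewrite addrAC subrr add0r clampK.
have tE : val t = 0 :> RR by apply: le_anti; rewrite t0 andbT; lra.
have -> : t = d1zero by apply: val_inj.
by rewrite /= addr0 clamp1 // f1 g0.
Qed.

Lemma path_inv A x y f : path_in A x y f ->
  exists2 h, path_in A y x h & sclass h = - sclass f.
Proof.
move=> [cf f0 f1 fA]; have cF := continuous_clamped cf.
exists (seg (f \o clamp) 1 0); last by rewrite seg_sym // seg_clamp.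
split; first exact: continuous_seg.
- by rewrite /seg /= mulr0 addr0 clamp1.
- by rewrite /seg /= mulr1 addrC subrK clamp0.
- by move=> t; exact: fA.
Qed.

End Classes.

(** * Finite generation in the absence of bad points *)

(** If [P A] failed, the sets whose complement in [A] satisfies [P] would form a proper filter
    containing [A], and a cluster point of it in [A] would contradict the local hypothesis. *)
Lemma compact_ind (T : topologicalType) (A : set T) (P : set T -> Prop) :
  compact A -> P set0 -> (forall U V, U `<=` V -> P V -> P U) ->
  (forall U V, P U -> P V -> P (U `|` V)) ->
  (forall x, A x -> exists2 U, nbhs x U & P U) -> P A.
Proof.
move=> cA P0 PS PU Ploc; apply: contrapT => nPA.
pose F : set_system T := [set B | P (A `\` B)].
have FF : ProperFilter F.
  split; first by rewrite /F /= setD0.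
  split.
  - by rewrite /F /= setDT.
  - by move=> B C FB FC; rewrite /F /= setDIr; exact: PU.
  - by move=> B C BC; apply: PS; exact: setDS.
have FA : F A by rewrite /F /= setDv.
have [x [Ax clx]] := cA F FF FA.
have [U nU PUU] := Ploc x Ax.
have FU : F (~` U) by rewrite /F /= setDE setCK; apply: PS PUU => y [].
by have [y []] := clx _ _ FU nU.
Qed.

Section FiniteGeneration.
Variable X : pseudoMetricType RR.
Variables (Q : zmodType) (p : {additive (sing1 X -> int) -> Q}).
Hypothesis p0 : forall z : chain (sing1 X), p (coef z) = 0 <-> boundary1 z.
Hypothesis cX : compact [set: X].
Hypothesis lX : locally_path_connected X.
Local Notation cls := (sclass p).

Definition bad_point (x : X) := forall (e : RR) (N : nat), 0 < e -> (0 < N)%N ->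
  exists2 f, path_in (ball x e) x x f & cls f *+ N <> 0.

(** By compactness it suffices to work near a point [x]. Local path connectedness joins a small loop
    near [x] to [x], and conjugation by the joining path preserves the class. *)
Lemma small_loops_torsion : (forall x, ~ bad_point x) ->
  exists (d : RR) (N : nat), [/\ 0 < d, (0 < N)%N &
    forall y x f, path_in (ball y d) x x f -> cls f *+ N = 0].
Proof.
move=> nbad.
suff [d [N [d0 N0 h]]] : exists (d : RR) (N : nat), [/\ 0 < d, (0 < N)%N &
    forall y, [set: X] y -> forall x f, path_in (ball y d) x x f -> cls f *+ N = 0].
  by exists d, N; split=> // y; apply: h.
apply: (compact_ind (P := fun U => exists (d : RR) (N : nat), [/\ 0 < d, (0 < N)%N &
    forall y, U y -> forall x f, path_in (ball y d) x x f -> cls f *+ N = 0])) cX _ _ _ _.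
- by exists 1, 1%N; split.
- by move=> U V UV [d [N [d0 N0 h]]]; exists d, N; split=> // y /UV; apply: h.
- move=> U V [d [N [d0 N0 h]]] [e [M [e0 M0 k]]].
  exists (Num.min d e), (N * M)%N; rewrite lt_min d0 e0 muln_gt0 N0; split=> //.
  move=> y [Uy|Vy] x f hf.
    rewrite mulrnA (h y Uy x) ?mul0rn //; apply: path_in_sub hf.
    by apply: le_ball; rewrite ge_min lexx.
  rewrite mulnC mulrnA (k y Vy x) ?mul0rn //; apply: path_in_sub hf.
  by apply: le_ball; rewrite ge_min lexx orbT.
move=> x _.
have [e [N [e0 N0 he]]] : exists (e : RR) (N : nat), [/\ 0 < e, (0 < N)%N &
    forall f, path_in (ball x e) x x f -> cls f *+ N = 0].
  apply: contrapT => h; apply: (nbad x) => e N e0 N0; apply: contrapT => h'.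
  apply: h; exists e, N; split=> // f hf; apply: contrapT => h2; apply: h'.
  by exists f.
have [V [nV [VB pV]]] := lX (nbhsx_ballx x e e0).
have /nbhs_ballP [d /= d0 dV] := nV.
exists (ball x (d / 2)); first by apply: nbhsx_ballx; lra.
exists (d / 2), N; split=> //; first by lra.
move=> y xy z f hf.
have fV t : V (f t).
  apply: dV; apply: (@ball_split _ _ y) => //.
  by have [_ _ _] := hf.
have Vz : V z by have [_ <- _ _] := hf.
have Vx : V x by apply: dV; apply: ballxx.
have [g gV] : exists g, path_in V x z g.
  by have [g [? [? [? ?]]]] := pV _ _ Vx Vz; exists g; split.
have [g' g'V g'E] := path_inv p0 gV.
have fV' : path_in V z z f by case: hf.
have [h1 h1V h1E] := path_cat p0 gV fV'.
have [h2 h2V h2E] := path_cat p0 h1V g'V.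
have := he h2 (path_in_sub VB h2V).
by rewrite h2E h1E g'E addrAC subrr add0r.
Qed.

Lemma finite_net (d : RR) : 0 < d -> exists s : seq X, forall y, exists2 x, x \in s &
  exists h, path_in (ball x d) x y h.
Proof.
move=> d0.
suff [s hs] : exists s : seq X, forall y, [set: X] y -> exists2 x, x \in s &
    exists h, path_in (ball x d) x y h by exists s => y; apply: hs.
apply: (compact_ind (P := fun U => exists s : seq X, forall y, U y ->
  exists2 x, x \in s & exists h, path_in (ball x d) x y h)) cX _ _ _ _.
- by exists [::].
- by move=> U V UV [s hs]; exists s => y /UV /hs.
- move=> U V [s hs] [t ht]; exists (s ++ t) => y [/hs|/ht] [x xs hx];
    by exists x; rewrite // mem_cat xs ?orbT.
move=> x _; have [V [nV [VB pV]]] := lX (nbhsx_ballx x d d0).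
exists V => //; exists [:: x] => y Vy; exists x; first by rewrite inE.
have [h [? [? [? hV]]]] := pV _ _ (nbhs_singleton nV) Vy.
by exists h; split=> // t; apply: VB.
Qed.

(** The equivalence classes are open, hence also closed, in the connected line. *)
Lemma real_connected (R : RR -> RR -> Prop) : (forall t, R t t) ->
  (forall s t, R s t -> R t s) -> (forall s t u, R s t -> R t u -> R s u) ->
  (forall t, \forall s \near t, R t s) -> forall s t, R s t.
Proof.
move=> Rr Rs Rt Rl s t.
have c : connected [set: RR] by apply/connected_intervalP.
have := c [set u | R s u]; move=> /(_ _ _ _) e.
suff : [set u | R s u] t by [].
rewrite e //.
- by exists s; apply: Rr.
- exists [set u | R s u]; last by rewrite setTI.
  rewrite openE => u Rsu; rewrite /interior.
  by apply: filterS (Rl u) => v; apply: Rt.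
- exists [set u | R s u]; last by rewrite setTI.
  move=> u clu; have [v [Rsv Ruv]] := clu _ (Rl u).
  by apply: Rt Rsv _; apply: Rs.
Qed.

(* Once loops of diameter [d] are killed by [N], a path between two points of a
   small ball is determined by its end points up to [N]-torsion. *)
Theorem fg_multiple_of_no_bad_point : (forall x, ~ bad_point x) ->
  exists (N : nat) (s : seq Q), (0 < N)%N /\
    forall z : chain (sing1 X), cycle1 z -> span s (hclass p z *+ N).
Proof.
move=> /small_loops_torsion [d [N [d0 N0 killed]]].
(* The path from one centre through [y] and [f d1one] to the next centre stays within [4 e] of the
   first centre. *)
pose e := d / 4; have e0 : 0 < e by rewrite /e; lra.
have [s hs] := finite_net e0.
have /choice [c hc] : forall y, exists c : X * sing1 X,
    c.1 \in s /\ path_in (ball c.1 e) c.1 y c.2.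
  by move=> y; have [x xs [h hh]] := hs y; exists (x, h).
pose i y := (c y).1; pose h y := (c y).2.
have /choice [g hg] : forall xy : X * X, exists g,
    (exists f, path_in (ball xy.1 d) xy.1 xy.2 f) ->
    path_in (ball xy.1 d) xy.1 xy.2 g.
  move=> [x y].
  have [[f hf]|no] := pselect (exists f, path_in (ball x d) x y f).
    by exists f.
  by exists (fun=> x) => /no.
(* One small path per pair of centres is enough: any other one differs from it by a small loop,
   killed by [N]. *)
pose G := [seq cls (g (x, y)) *+ N | x <- s, y <- s].
exists N, G; split=> //.
have hG := subgroup_span G.
(* The path [f] is prolonged at both ends to centres of the net, so that corrections cancel when
   paths are composed. *)
pose D f := span G ((cls f - cls (h (f d1one)) + cls (h (f d1zero))) *+ N).
have small y f : continuous f -> (forall t, ball y e (f t)) -> f d1zero = y -> D f.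
  move=> cf fy f0; have [iy hy] := hc y; have [iz hz] := hc (f d1one).
  have [hc1 hh0 hh1 hhy] := hy; have [hc2 hk0 hk1 hhz] := hz.
  have near1 u : ball y e u -> ball (i y) (e + e) u.
    by move=> yu; apply: ball_triangle yu; rewrite -[X in ball _ _ X]hh1; apply: hhy.
  have near2 u : ball (i (f d1one)) e u -> ball (i y) d u.
    move=> zu; have -> : d = (e + e) + (e + e) by rewrite /e; lra.
    apply: ball_triangle (near1 _ (fy d1one)) _.
    apply: ball_triangle zu; apply: ball_sym; rewrite -[X in ball _ _ X]hk1; exact: hhz.
  have p1 : path_in (ball (i y) d) (i y) y (h y).
    by apply: path_in_sub hy; apply: le_ball; rewrite /e; lra.
  have p2 : path_in (ball (i y) d) y (f d1one) f.
    split=> // t; apply: le_ball (near1 _ (fy t)); rewrite /e; lra.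
  have p3 : path_in (ball (i y) d) (i (f d1one)) (f d1one) (h (f d1one)).
    by apply: path_in_sub hz => u; exact: near2.
  have [p3' p3'P p3'E] := path_inv p0 p3.
  have [k1 k1P k1E] := path_cat p0 p1 p2.
  have [k2 k2P k2E] := path_cat p0 k1P p3'P.
  have gP := hg (i y, i (f d1one)) (ex_intro _ k2 k2P).
  have [g' g'P g'E] := path_inv p0 gP.
  have [k kP kE] := path_cat p0 k2P g'P.
  have := killed _ _ _ kP.
  rewrite kE k2E k1E p3'E g'E mulrnBl => /eqP; rewrite subr_eq0 => /eqP ke.
  rewrite /D f0.
  have -> : cls f - cls (h (f d1one)) + cls (h y) =
      cls (h y) + cls f - cls (h (f d1one)) by rewrite addrC addrA.
  by rewrite ke; apply: span_mem; apply/allpairsP; exists (i y, i (f d1one)).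
(* Along a path, [D] of the segment from [a] to [b] is an equivalence relation that holds locally by
   [small]; connectedness replaces a subdivision. *)
have all f : continuous f -> D f.
  move=> cf; rewrite -(seg_clamp f); have cF := continuous_clamped cf.
  move: (f \o clamp) cF => F cF; apply: (@real_connected (fun a b => D (seg F a b))).
  - move=> a; rewrite /D (seg_refl p0) // /seg !subrr !mul0r add0r.
    by rewrite addrC subrr mul0rn; exact: hG.1.
  - move=> a b hD; rewrite /D (seg_sym p0) //.
    move: (subgroupN hG hD); rewrite /D -mulNrn !opprD opprK /seg /=.
    rewrite !mulr0 !mulr1 !addr0 ![_ + (_ - _)]addrC !subrK.
    by rewrite addrAC.
  - move=> a b k h1 h2; have := subgroupD hG h1 h2; rewrite /D /seg /= -mulrnDl.
    rewrite !mulr0 !mulr1 !addr0 ![_ + (_ - _)]addrC !subrK.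
    rewrite -/(seg F a b) -/(seg F b k) -/(seg F a k) -(seg_add p0 a b k cF).
    set u := cls (seg F a b); set v := cls (seg F b k).
    set w := cls (h (F b)).
    congr (span G (_ *+ N)).
    by rewrite [u - w + _]addrAC addrACA addNr addr0 addrAC addrA.
  - move=> a; have := cF a _ (nbhsx_ballx (F a) e e0).
    move=> /nbhs_ballP [r /= r0 hr]; apply/nbhs_ballP; exists r => // b ab /=.
    apply: (small (F a)); first exact: continuous_seg.
      move=> t; apply: hr; move: ab; rewrite /seg /ball /= => ab.
      have [t0 t1] := Delta1_bounds t.
      rewrite opprD addrA subrr sub0r normrN normrM (ger0_norm t0).
      rewrite distrC in ab; apply: le_lt_trans ab.
      by rewrite ler_piMr.
    by rewrite /seg /= mulr0 addr0.
move=> z [zc z0].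
(* The end corrections add up to the extension of [cls \o h] evaluated on the boundary of [z], which
   vanishes. *)
have bd : \sum_(q <- z) (cls (h (q.2 d1one)) - cls (h (q.2 d1zero))) *~ q.1 = 0.
  rewrite -[RHS](@sum_coef0 X Q (fun x => cls (h x)) (bd1 z)); last first.
    by move=> x; rewrite z0 /coef big_nil.
  rewrite /bd1 big_flatten big_map; apply: eq_bigr => q _.
  by rewrite !big_cons big_nil /= addr0 mulrNz -mulNrz -mulrzDl.
rewrite -(subr0 (hclass p z)) -bd (hclass_sum p0) -sumrB -sumrMnl.
apply: subgroup_sum => // q qz.
rewrite -mulrzBl opprB addrA.
rewrite pmulrn -mulrzA mulrC mulrzA -pmulrn; apply: subgroupMz => //.
have := all _ (zc q qz); rewrite /D.
by congr (span G (_ *+ N)); rewrite addrAC.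
Qed.

End FiniteGeneration.

(** * Infinite concatenations of loops *)

Definition rinv (m : nat) : RR := m.+1%:R^-1.

Lemma rinv_gt0 m : 0 < rinv m.
Proof. by rewrite invr_gt0 ltr0Sn. Qed.

Lemma rinv_le m n : (m <= n)%N -> rinv n <= rinv m.
Proof. by move=> mn; rewrite lef_pV2 ?posrE ?ltr0Sn // ler_nat ltnS. Qed.

Lemma rinvS_lt m : rinv m.+1 < rinv m.
Proof. by rewrite ltf_pV2 ?posrE ?ltr0Sn // ltr_nat. Qed.

Lemma rinv_small (e : RR) : 0 < e -> rinv (Num.truncn e^-1) < e.
Proof.
move=> e0; rewrite -[X in _ < X]invrK ltf_pV2 ?posrE ?ltr0Sn ?invr_gt0 //.
by apply: truncnS_gt.
Qed.

Lemma compact_tri : compact tri.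
Proof.
have cf : continuous (fst : RR * RR -> RR) by move=> x; exact: cvg_fst.
have cs : continuous (snd : RR * RR -> RR) by move=> x; exact: cvg_snd.
have ct : compact ((`[0, 1]%classic : set RR) `*` (`[0, 1]%classic : set RR)).
  by apply: compact_setX; exact: segment_compact.
apply: (subclosed_compact _ ct).
- have -> : tri = (fst @^-1` [set x : RR | 0 <= x]) `&`
     ((snd @^-1` [set x : RR | 0 <= x]) `&`
      ((fun x : RR * RR => x.1 + x.2) @^-1` [set x : RR | x <= 1])) by [].
  apply: closedI; first by apply: (continuous_closedP fst).1 => //; exact: closed_ge.
  apply: closedI; first by apply: (continuous_closedP snd).1 => //; exact: closed_ge.
  apply: (continuous_closedP (fun x : RR * RR => x.1 + x.2)).1; last exact: closed_le.
  exact: (real_continuousD cf cs).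
- by move=> [a b] [/= a0 [b0 ab]]; split; rewrite /= in_itv /=; lra.
Qed.

Lemma uniformly_continuous_Delta2 (X : pseudoMetricType RR) (s : Delta2 -> X) e :
  continuous s -> 0 < e -> exists m, forall m', (m <= m')%N ->
    forall x y, ball x (rinv m') y -> ball (s x) e (s y).
Proof.
move=> cs e0.
suff [m hm] : exists m, forall x : Delta2, tri (val x) -> forall m', (m <= m')%N ->
    forall y, ball x (rinv m') y -> ball (s x) e (s y).
  exists m => m' mm' x y; apply: hm => //; exact: set_valP.
apply: (compact_ind (P := fun U => exists m, forall x : Delta2, U (val x) ->
    forall m', (m <= m')%N -> forall y, ball x (rinv m') y -> ball (s x) e (s y)))
  compact_tri _ _ _ _.
- by exists 0%N.
- by move=> U V UV [m hm]; exists m => x /UV; apply: hm.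
- move=> U V [m hm] [n hn]; exists (maxn m n) => x [Ux|Vx] m'; rewrite geq_max => /andP[h1 h2].
    exact: hm.
  exact: hn.
move=> x tx; pose x' : Delta2 := SigSub (mem_set tx).
have e20 : 0 < e / 2 by lra.
have /nbhs_ballP [r /= r0 hr] := cs x' _ (nbhsx_ballx (s x') _ e20).
have r20 : 0 < r / 2 by lra.
exists (ball x (r / 2)); first exact: nbhsx_ballx.
exists (Num.truncn (r / 2)^-1) => y xy m' mm' z yz.
apply: (@ball_split _ _ (s x')).
  by apply: ball_sym; apply: hr; apply: le_ball (xy : ball x' (r / 2) y); lra.
apply: hr; apply: (@ball_split _ _ y); first exact: xy.
by apply: le_ball yz; apply: le_trans (rinv_le mm') (ltW (rinv_small r20)).
Qed.

Section InfiniteConcatenation.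
Variables (X : pseudoMetricType RR) (x0 : X) (lam : nat -> sing1 X).
Hypothesis lamP : forall m, path_in (ball x0 (rinv m)) x0 x0 (lam m).
Implicit Types (al : nat -> bool) (t : RR).

(** The loop [lam m] run on the interval from [1/(m+2)] to [1/(m+1)], and constantly [x0] outside it
    or when [al m] is false. *)
Definition block al m t :=
  if al m then lam m (clamp ((t - rinv m.+1) / (rinv m - rinv m.+1))) else x0.

Let len_gt0 m : 0 < rinv m - rinv m.+1.
Proof. by rewrite subr_gt0 rinvS_lt. Qed.

Lemma block_left al m t : t <= rinv m.+1 -> block al m t = x0.
Proof.
move=> h; rewrite /block; case: ifP => // _; rewrite clamp0; first by have [] := lamP m.
by rewrite pmulr_lle0 ?invr_gt0 // subr_le0.
Qed.

Lemma block_right al m t : rinv m <= t -> block al m t = x0.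
Proof.
move=> h; rewrite /block; case: ifP => // _; rewrite clamp1; first by have [] := lamP m.
by rewrite ler_pdivlMr // mul1r lerD2r.
Qed.

Lemma block_ball al m t : ball x0 (rinv m) (block al m t).
Proof.
rewrite /block; case: ifP => _; first by have [_ _ _] := lamP m.
by apply: ballxx; exact: rinv_gt0.
Qed.

Lemma continuous_block al m : continuous (block al m).
Proof.
rewrite /block; case: (al m); last exact: cst_continuous.
move=> t; apply: continuous_comp; last by have [c _ _ _] := lamP m; exact: c.
apply: continuous_comp; last exact: continuous_clamp.
pose f (t : RR) := t - rinv m.+1; pose c (t : RR) := (rinv m - rinv m.+1)^-1.
have cf : continuous f by apply: real_continuousB => u; [exact: cvg_id|exact: cvg_cst].
have cc : continuous c by exact: cst_continuous.
exact: (real_continuousM cf cc).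
Qed.

Fixpoint blocks al m : RR -> X :=
  if m is m'.+1 then fun t => if t <= rinv m' then block al m' t else blocks al m' t
  else fun=> x0.

Lemma blocks_left al m t : t <= rinv m -> blocks al m t = x0.
Proof.
case: m => // m h /=; rewrite (le_trans h (ltW (rinvS_lt m))).
exact: block_left.
Qed.

Lemma continuous_blocks al m : continuous (blocks al m).
Proof.
elim: m => [|m IH]; first exact: cst_continuous.
apply: continuous_glue => //; first exact: continuous_block.
by rewrite block_right //; apply: esym; exact: blocks_left.
Qed.

Lemma blocks_stable al m n t : (m <= n)%N -> rinv m <= t -> blocks al n t = blocks al m t.
Proof.
move=> mn mt; elim: n mn => [|n IH]; first by rewrite leqn0 => /eqP->.
rewrite leq_eqVlt => /orP[/eqP->//|mn] /=; rewrite IH //.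
have [h|//] := leP t (rinv n).
have -> : t = rinv m by apply: le_anti; rewrite mt (le_trans h) // rinv_le.
by rewrite blocks_left // block_right // rinv_le.
Qed.

Lemma blocks_ball al m n t : t <= rinv m -> ball x0 (rinv m) (blocks al n t).
Proof.
move=> h; elim: n => [|n IH] /=; first by apply: ballxx; exact: rinv_gt0.
case: ifP => // _; have [mn|nm] := leqP m n.
  by apply: le_ball (block_ball al n t); exact: rinv_le.
rewrite block_left; last by apply: le_trans h _; exact: rinv_le.
by apply: ballxx; exact: rinv_gt0.
Qed.

Lemma blocks_eq al al' n t : (forall i, (i < n)%N -> al i = al' i) ->
  blocks al n t = blocks al' n t.
Proof.
elim: n => // n IH h /=; rewrite IH; last by move=> i hi; apply: h; exact: ltnW.
by rewrite /block h.
Qed.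

Lemma blocks_tail al al' k n t : t <= rinv k.+1 -> (forall i, (k < i)%N -> al i = al' i) ->
  blocks al n t = blocks al' n t.
Proof.
move=> tk h; elim: n => //= n ->; case: ifP => // _.
have [nk|kn] := leqP n k; last by rewrite /block h.
by rewrite !block_left // (le_trans tk) // rinv_le.
Qed.

(** The blocks accumulate at 0. For [t > 0] the chosen index [n] satisfies [rinv n < t], so further
    blocks do not change the value at [t]. *)
Definition concat al t :=
  if t <= 0 then x0 else blocks al (Num.truncn t^-1) t.

Lemma concatE al m t : rinv m <= t -> concat al t = blocks al m t.
Proof.
move=> mt; have t0 : 0 < t by apply: lt_le_trans mt; exact: rinv_gt0.
rewrite /concat leNgt t0 /=; set n := Num.truncn _.
have nt : rinv n <= t by apply: ltW; exact: rinv_small.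
by rewrite -(blocks_stable al (leq_maxl n m) nt) -(blocks_stable al (leq_maxr n m) mt).
Qed.

(** Locally a finite concatenation on [t > 0]; at [t <= 0] continuity holds because the loops shrink
    to [x0]. *)
Lemma continuous_concat al : continuous (concat al).
Proof.
move=> t; have [t0|t0] := ltP 0 t.
  pose m := Num.truncn t^-1.
  have mt : rinv m < t by exact: rinv_small.
  have e : \forall s \near t, blocks al m s = concat al s.
    by apply: filterS (lt_nbhsr mt) => s ms; rewrite (concatE al (ltW ms)).
  have h : continuous (blocks al m) by exact: continuous_blocks.
  move=> U; rewrite (concatE al (ltW mt)) => hU.
  change (nbhs t [set s | U (concat al s)]).
  have h1 : nbhs t (blocks al m @^-1` U) by apply: (h t).
  by apply: filterS (filterI e h1) => s [/= <-].
have tE : concat al t = x0 by rewrite /concat t0.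
move=> U; rewrite tE => /nbhs_ballP [e /= e0 eU]; change (nbhs t [set s | U (concat al s)]).
have tr : t < rinv (Num.truncn e^-1) by apply: le_lt_trans t0 (rinv_gt0 _).
apply: filterS (lt_nbhsl tr) => s sr /=; apply: eU.
rewrite /concat; case: ifP => _; first exact: ballxx.
apply: le_ball (ltW (rinv_small e0)) _ _; apply: blocks_ball; exact: ltW.
Qed.

Definition phi al : sing1 X := fun t : Delta1 => concat al (val t).

Lemma phi_seg al : phi al = seg (concat al) 0 1.
Proof. by apply/funext => t; rewrite /phi /seg subr0 mul1r add0r. Qed.

Lemma continuous_phi al : continuous (phi al).
Proof. by rewrite phi_seg; apply: continuous_seg; exact: continuous_concat. Qed.

Lemma phi0 al : phi al d1zero = x0.
Proof. by rewrite /phi /concat /= lexx. Qed.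

Lemma phi1 al : phi al d1one = x0.
Proof. by rewrite /phi /= (@concatE _ 0) //= /rinv invr1. Qed.

Lemma phi_local al (t : Delta1) : exists j, forall al', (forall i, (i < j)%N -> al' i = al i) ->
  phi al' t = phi al t.
Proof.
exists (Num.truncn (val t)^-1) => al' h; rewrite /phi /concat; case: ifP => // _.
exact: blocks_eq.
Qed.

Variables (Q : zmodType) (p : {additive (sing1 X -> int) -> Q}).
Hypothesis p0 : forall z : chain (sing1 X), p (coef z) = 0 <-> boundary1 z.

(** Both paths are cut at [rinv k.+1] and [rinv k]. The outer pieces agree; the middle ones are
    [lam k] and a constant path. *)
Lemma phi_flip al al' k : (forall i, i != k -> al i = al' i) -> al k -> ~~ al' k ->
  sclass p (phi al) - sclass p (phi al') = sclass p (lam k).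
Proof.
move=> h ak ak'; have c := @continuous_concat al; have c' := @continuous_concat al'.
rewrite !phi_seg -(seg_add p0 0 (rinv k) 1 c) -(seg_add p0 0 (rinv k) 1 c').
rewrite -(seg_add p0 0 (rinv k.+1) (rinv k) c) -(seg_add p0 0 (rinv k.+1) (rinv k) c').
have -> : seg (concat al) 0 (rinv k.+1) = seg (concat al') 0 (rinv k.+1).
  apply/funext => t; rewrite /seg subr0 add0r /concat; case: ifP => // _.
  have [t0 t1] := Delta1_bounds t.
  apply: (@blocks_tail _ _ k).
    by rewrite -[X in _ <= X]mulr1 ler_wpM2l // ltW // rinv_gt0.
  by move=> i ki; apply: h; rewrite neq_ltn ki orbT.
have -> : seg (concat al) (rinv k) 1 = seg (concat al') (rinv k) 1.
  apply/funext => t; rewrite /seg; have [t0 t1] := Delta1_bounds t.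
  have rt : rinv k <= rinv k + (1 - rinv k) * val t.
    rewrite lerDl mulr_ge0 // subr_ge0; have := rinv_le (leq0n k).
    by rewrite {2}/rinv invr1.
  rewrite !(@concatE _ k) //; apply: blocks_eq => i ik.
  by apply: h; rewrite neq_ltn ik.
have mid a : forall t : Delta1, concat a (rinv k.+1 + (rinv k - rinv k.+1) * val t) =
    if a k then lam k t else x0.
  move=> t; have [t0 t1] := Delta1_bounds t.
  rewrite (@concatE _ k.+1) ?lerDl ?mulr_ge0 ?(ltW (len_gt0 k)) //= ifT.
    rewrite /block; case: ifP => // _; congr (lam k _).
    by rewrite addrAC subrr add0r mulrAC divff ?mul1r ?clampK // gt_eqF.
  rewrite -lerBrDl -[X in _ <= X]mulr1 ler_wpM2l // ltW //; exact: len_gt0.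
have -> : seg (concat al) (rinv k.+1) (rinv k) = lam k.
  by apply/funext => t; rewrite /seg mid ak.
have -> : sclass p (seg (concat al') (rinv k.+1) (rinv k)) = 0.
  rewrite -(@seg_refl _ _ _ p0 (fun=> x0) 0); last exact: cst_continuous.
  by congr sclass; apply/funext => t; rewrite /seg mid (negPf ak').
set u := sclass p (seg _ 0 _); set v := sclass p (seg _ _ 1).
by rewrite addr0 opprD addrACA subrr addr0 addrAC subrr add0r.
Qed.

End InfiniteConcatenation.

(** * Analyticity and the main theorem *)

Lemma nat_ultrafilter : exists U : set_system nat, UltraFilter U /\ \oo `<=` U.
Proof. exact: ultraFilterLemma. Qed.

Lemma ultra_cvg (X : topologicalType) (U : set_system nat) (u : nat -> X) :
  compact [set: X] -> UltraFilter U -> exists l : X, u @ U --> l.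
Proof.
move=> cX UU; have [|l [_ cl]] := cX (u @ U) _; first exact: filterT.
exists l => V nV; have [//|h] := in_ultra_setVsetC (u @^-1` V) UU.
have [x [nVx Vx]] := cl (~` V) V h nV; by case: nVx.
Qed.

Section Continuum.
Variables (X : pseudoMetricType RR) (x0 : X) (lam : nat -> sing1 X).
Hypothesis lamP : forall m, path_in (ball x0 (rinv m)) x0 x0 (lam m).
Hypothesis cX : compact [set: X].
Hypothesis hX : hausdorff_space X.
Variables (Q : zmodType) (p : {additive (sing1 X -> int) -> Q}).
Hypothesis p0 : forall z : chain (sing1 X), p (coef z) = 0 <-> boundary1 z.
Local Notation cantor := (nat -> bool).
Local Notation phi := (phi x0 lam).
Local Notation cls := (sclass p).

Local Notation label := (bool + nat * nat)%type.

(** The chain [n (phi x.1 - phi x.2)] minus the boundary of a 2-chain, with labels for simplices: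
    [inl] marks the two loops, [inr (i, j)] the face [j] of the triangle [i]. *)
Definition pattern (n : nat) (cs : chain nat) : chain label :=
  [:: (n%:Z, inl true); (- n%:Z, inl false)] ++
  flatten [seq [:: (-1 * q.1, inr (q.2, 0%N)); (-1 * - q.1, inr (q.2, 1%N));
                   (-1 * q.1, inr (q.2, 2%N))] | q <- cs].

Definition interp (x : cantor * cantor) (sg : nat -> sing2 X) (a : label) : sing1 X :=
  match a with
  | inl b => phi (if b then x.1 else x.2)
  | inr (i, 0%N) => sg i \o face0
  | inr (i, 1%N) => sg i \o face1
  | inr (i, _) => sg i \o face2
  end.

Lemma cmap_pattern n cs x sg : cmap (interp x sg) (pattern n cs) =
  csub [:: (n%:Z, phi x.1); (- n%:Z, phi x.2)] (bd2 (cmap sg cs)).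
Proof.
rewrite /csub /pattern /cmap /cscale /bd2 map_cat; congr (_ ++ _).
by rewrite !map_flatten -!map_comp.
Qed.

(* The relation [n (phi a - phi b) = 0] is analytic: [M 0] codes the coefficients
   of a bounding 2-chain together with the pattern of cancellations, and the other
   values of [M] are moduli of continuity for its simplices. *)
Definition bounds n (M : nat -> nat) : set (cantor * cantor) :=
  [set x | exists (sg : nat -> sing2 X) (v : nat -> sing1 X)
                  (cs d : seq (int * nat)),
    [/\ forall i, coef d i = 0, M 0%N = pickle (cs, d),
        cmap (interp x sg) (pattern n cs) = cmap v d &
        forall k i e (y z : Delta2), rinv k < e -> ball y (rinv (M k.+1)) z ->
          ball (sg i y) e (sg i z)]].

Lemma cmap_limit (S S' : Type) (U : set_system nat) (c : chain S) (d : chain S')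
    (f : nat -> S -> sing1 X) (g : nat -> S' -> sing1 X) f' g' : ProperFilter U ->
  (forall s t, f j s t @[j --> U] --> (f' s t : X)) ->
  (forall s t, g j s t @[j --> U] --> (g' s t : X)) ->
  (forall j, cmap (f j) c = cmap (g j) d) -> cmap f' c = cmap g' d.
Proof.
move=> PU ff' gg'; elim: c d => [|q c IH] [|r d] h //=; try by have := h 0%N.
congr (_ :: _); last by apply: IH => j; have [] := h j.
have -> : q.1 = r.1 by have [] := h 0%N.
congr (_, _); apply/funext => t.
apply: (cvg_unique hX (ff' q.2 t)).
suff -> : (fun j => f j q.2 t) = (fun j => g j r.2 t) by exact: gg'.
by apply/funext => j; have [_ -> _] := h j.
Qed.

(** The approximants share the code [M 0], hence the same finite pattern. Compactness gives
    pointwise limits of their simplices along an ultrafilter, equalities pass to the limit since [X]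
    is Hausdorff, and the moduli in [M] survive. *)
Lemma bounds_closed n M x :
  (forall j, exists M' x', [/\ forall i, (i < j)%N ->
     [/\ M' i = M i, x'.1 i = x.1 i & x'.2 i = x.2 i] & bounds n M' x']) ->
  bounds n M x.
Proof.
move=> h; have [U [UU oU]] := nat_ultrafilter.
have PU : ProperFilter U by exact: ultra_proper.
have /choice [L hL] : forall u : nat -> X, exists l : X, u @ U --> l.
  by move=> u; exact: ultra_cvg.
have /choice [D hD] : forall j, exists D : (nat -> nat) * (cantor * cantor) *
    (nat -> sing2 X) * (nat -> sing1 X) * (seq (int * nat) * seq (int * nat)),
    let: (M', x', sg, v, (cs, d)) := D in
    (forall i, (i < j.+1)%N -> [/\ M' i = M i, x'.1 i = x.1 i & x'.2 i = x.2 i]) /\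
    [/\ forall i, coef d i = 0, M' 0%N = pickle (cs, d),
        cmap (interp x' sg) (pattern n cs) = cmap v d &
        forall k i e (y z : Delta2), rinv k < e -> ball y (rinv (M' k.+1)) z ->
          ball (sg i y) e (sg i z)].
  (* The shift to [j.+1] makes even stage 0 agree with [M] at 0, where the code is stored. *)
  move=> j; have [M' [x' [hi [sg [v [cs [d hh]]]]]]] := h j.+1.
  by exists (M', x', sg, v, (cs, d)).
pose xx j := (D j).1.1.1.2; pose sg j := (D j).1.1.2; pose v j := (D j).1.2.
pose MM j := (D j).1.1.1.1.
pose cs := (D 0%N).2.1; pose d := (D 0%N).2.2.
have {}hD j : (forall i, (i < j.+1)%N ->
      [/\ MM j i = M i, (xx j).1 i = x.1 i & (xx j).2 i = x.2 i]) /\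
    [/\ forall i, coef d i = 0, M 0%N = pickle (cs, d),
        cmap (interp (xx j) (sg j)) (pattern n cs) = cmap (v j) d &
        forall k i e (y z : Delta2), rinv k < e -> ball y (rinv (MM j k.+1)) z ->
          ball (sg j i y) e (sg j i z)].
  have := hD 0%N; have := hD j; rewrite /MM /xx /sg /v /cs /d.
  case: (D j) (D 0%N) => [[[[M1 x1] s1] v1] [c1 d1]] [[[[M2 x2] s2] v2] [c2 d2]] /=.
  move=> [a1 [b1 e1 f1 g1]] [a2 [b2 e2 f2 g2]].
  have M1E : M 0%N = pickle (c1, d1) by rewrite -e1; have [] := a1 0%N isT.
  have M2E : M 0%N = pickle (c2, d2) by rewrite -e2; have [] := a2 0%N isT.
  have [ec ed] : (c1, d1) = (c2, d2).
    by apply: (pcan_inj pickleK); rewrite -M1E.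
  by rewrite -ec -ed.
have eventually_ge m : U [set j | (m <= j)%N] by apply: oU; exists m.
exists (fun i y => L (fun j => sg j i y)), (fun i t => L (fun j => v j i t)), cs, d.
have [_ [d0 M0 _ _]] := hD 0%N; split=> //.
- apply: (@cmap_limit _ _ U _ _ (fun j => interp (xx j) (sg j)) v) => //.
  + have phil b t : phi (if b then (xx j).1 else (xx j).2) t @[j --> U] -->
        (phi (if b then x.1 else x.2) t : X).
      apply: cvg_near_cst; have [m hm] := phi_local x0 lam (if b then x.1 else x.2) t.
      apply: filterS (eventually_ge m) => j /= mj; apply: hm => i im.
      have [_ h1 h2] := (hD j).1 i (ltn_trans im (mj : (m < j.+1)%N)).
      by case: b.
    move=> [b|[i [|[|k]]]] t; [exact: phil|exact: hL|exact: hL|exact: hL].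
  + move=> j; have [_ [_ _ e _]] := hD j; exact: e.
(* The strict inequality [rinv k < e] leaves room for the errors of the passage to the limit. *)
move=> k i e y z ke yz; pose e' := (e - rinv k) / 4.
have e'0 : 0 < e' by rewrite /e'; lra.
have hy : U [set j | ball (L (fun j => sg j i y)) e' (sg j i y)].
  by apply: (hL (fun j => sg j i y)); exact: nbhsx_ballx.
have hz : U [set j | ball (L (fun j => sg j i z)) e' (sg j i z)].
  by apply: (hL (fun j => sg j i z)); exact: nbhsx_ballx.
have [j [[/= jy jz] kj]] := filter_ex (filterI (filterI hy hz) (eventually_ge k.+1)).
have [/(_ k.+1 kj) [Mk _ _] [_ _ _ /(_ k i (rinv k + e') y z)]] := hD j.
rewrite ltrDl => /(_ e'0); rewrite Mk => /(_ yz) b.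
have -> : e = e' + (rinv k + e') + e' + e' by rewrite /e'; lra.
apply: (@le_ball _ _ _ (e' + (rinv k + e') + e')); first by lra.
apply: ball_triangle (ball_triangle jy b) _; exact: ball_sym.
Qed.

Lemma common_modulus (w : chain (sing2 X)) k : sing_chain2 w ->
  exists m, forall m', (m <= m')%N -> forall q, q \in w ->
    forall y z, ball y (rinv m') z -> ball (q.2 y) (rinv k) (q.2 z).
Proof.
elim: w => [|q w IH] hw; first by exists 0%N.
have [|m hm] := IH; first by move=> r rw; apply: hw; rewrite in_cons rw orbT.
have [m1 hm1] := uniformly_continuous_Delta2 (hw q (mem_head _ _)) (rinv_gt0 k).
exists (maxn m m1) => m'; rewrite geq_max => /andP[mm' m1m'] r.
by rewrite in_cons => /orP[/eqP->|/hm]; [exact: hm1|exact].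
Qed.

(** A witness yields a bounding 2-chain because its moduli make the simplices continuous.
    Conversely, the finitely many simplices of a bounding chain have common moduli by uniform
    continuity. *)
Lemma boundsP n x :
  (exists M, bounds n M x) <-> (cls (phi x.1) - cls (phi x.2)) *+ n = 0.
Proof.
pose c : chain (sing1 X) := [:: (n%:Z, phi x.1); (- n%:Z, phi x.2)].
have <- : hclass p c = (cls (phi x.1) - cls (phi x.2)) *+ n.
  rewrite (hclass_sum p0) !big_cons big_nil /= addr0 mulrNz -mulrzBl.
  by rewrite -pmulrn.
split.
  move=> [M [sg [v [cs [d [d0 _ e h]]]]]]; apply/p0; exists (cmap sg cs); split.
    move=> _ /mapP[q _ ->] /= y V /nbhs_ballP [r /= r0 rV].
    apply/nbhs_ballP; exists (rinv (M (Num.truncn r^-1).+1)); first exact: rinv_gt0.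
    by move=> z yz; apply: rV; apply: h yz; exact: rinv_small.
  move=> s; have := coef_cmap0 v d0 s; rewrite -e cmap_pattern -/c /csub.
  rewrite coef_cat coef_scale mulrN1z => /eqP; rewrite subr_eq0.
  by move/eqP.
move=> /p0 [w [hw zw]].
have [s|d [v [d0 e]]] := @coef0_cmap _ (fun=> x0) (csub c (bd2 w)).
  by rewrite /csub coef_cat coef_scale (funext zw) mulrN1z subrr.
(* Labels beyond the length of [w] are read as constant simplices, for which every modulus works. *)
pose q0 : int * sing2 X := (0, fun=> x0).
pose sg i := (nth q0 w i).2.
pose cs : chain nat := mkseq (fun i => ((nth q0 w i).1, i)) (size w).
have wE : cmap sg cs = w.
  rewrite /cmap /cs /mkseq -map_comp -[RHS](mkseq_nth q0); apply: eq_map => i /=.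
  by rewrite /sg; case: nth.
have /choice [mm hmm] := fun k => common_modulus k hw.
exists (fun k => if k is k'.+1 then mm k' else pickle (cs : seq (int * nat), d : seq (int * nat))).
exists sg, v, cs, d; split=> //.
  by rewrite cmap_pattern wE -e.
move=> k i r y z kr yz; apply: le_ball (ltW kr) _ _.
rewrite /sg; have [iw|wi] := ltnP i (size w).
  by apply: hmm yz => //; exact: mem_nth.
by rewrite nth_default //=; apply: ballxx; exact: rinv_gt0.
Qed.

Theorem continuum_many : (forall k, cls (lam k) *+ k`! <> 0) ->
  ~ tf_H1_card_lt_continuum X.
Proof.
move=> hlam; apply.
(* Factorials cover all torsion, as [n] divides its factorial, and they divide one another, which
   brings in the hypothesis on [lam k] for [k >= n]. *)
pose R n : set (cantor * cantor) := [set x | exists M, bounds n`! M x].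
have mR n : meager (R n).
  apply: contrapT => nm.
  have [||k [a [a' [b [nk aa' ak Rab Ra'b]]]]] := @analytic_nonmeager_flip (bounds n`!) _ n.
  - exact: bounds_closed.
  - by move=> hm; apply: nm; apply: meager_sub hm => x [M hM]; exists M.
  have {Rab} /boundsP /= h1 : exists M, bounds n`! M (a, b) by case: Rab => M _; exists M.
  have {Ra'b} /boundsP /= h2 : exists M, bounds n`! M (a', b) by case: Ra'b => M _; exists M.
  have diff : (cls (phi a) - cls (phi a')) *+ n`! = 0.
    rewrite -[cls (phi a) - _](subrKA (cls (phi b))) -[_ - cls (phi a')]opprB.
    by rewrite mulrnBl h1 h2 subrr.
  have lam0 : cls (lam k) *+ n`! = 0.
    have [ka|ka] := boolP (a k).
      have ka' : ~~ a' k by apply/negP => ka'; apply: ak; rewrite ka ka'.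
      by rewrite -(phi_flip lamP p0 aa' ka ka').
    have ka' : a' k by apply: contrapT => /negP ka'; apply: ak; rewrite (negPf ka) (negPf ka').
    rewrite -(phi_flip lamP p0 (fun i ik => esym (aa' i ik)) ka' ka).
    by rewrite -opprB mulNrn diff oppr0.
  apply: (hlam k); have /dvdnP[q ->] : (n`! %| k`!)%N.
    by rewrite -(subnK nk) addnC; elim: (k - n)%N => [|m IH];
      rewrite ?addn0 // addnS factS dvdn_mull.
  by rewrite mulnC mulrnA lam0 mul0rn.
have [f hf] := mycielski (meager_bigcup mR).
exists (fun a => [:: (1, phi (f a))]); split.
  move=> a; split; first by move=> q; rewrite inE => /eqP-> /=; exact: continuous_phi.
  move=> y; rewrite /coef /bd1 /= phi0 // phi1 // !big_cons big_nil /=.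
  by case: eqP => // _; rewrite addr0 subrr.
move=> a b ab [n [n0 /p0]]; rewrite -/(hclass p _) hclass_scale hclass_csub.
rewrite -/(cls (phi (f a))) -/(cls (phi (f b))) -pmulrn => e.
apply: (hf a b ab); exists n => //; apply/boundsP => /=.
have /dvdnP[q ->] : (n %| n`!)%N by rewrite dvdn_fact // n0 leqnn.
by rewrite mulnC mulrnA e mul0rn.
Qed.

End Continuum.

Theorem theoremA (X : pseudoMetricType Rdefinitions.R) :
  peano_continuum X ->
  tf_H1_card_lt_continuum X ->
  H1_direct_sum_of_cyclic X /\ tor_H1_bounded_exponent X.
Proof.
move=> [_ [hX [cX [_ lX]]]] small.
have [Q [p p0]] := H1_quotient X.
have nbad x : ~ bad_point p x.
  move=> bad.
  have /choice [lam hlam] : forall k, exists f,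
      path_in (ball x (rinv k)) x x f /\ sclass p f *+ k`! <> 0.
    by move=> k; have [f] := bad _ _ (rinv_gt0 k) (fact_gt0 k); exists f.
  by apply: (continuum_many (fun k => (hlam k).1) cX hX p0) small => k; have [] := hlam k.
have [N [s [N0 hN]]] := fg_multiple_of_no_bad_point p0 cX lX nbad.
(* The copy of [H_1] inside [Q], to which the algebra is applied. *)
pose A : set Q := [set hclass p z | z in @cycle1 X].
have hA : subgroup A.
  split.
    exists [::]; last exact: hclass_nil.
    by split=> // y; rewrite /coef !big_nil.
  move=> _ _ [z [zc z0] <-] [z' [zc' z0'] <-].
  exists (csub z z'); last by rewrite hclass_csub.
  split.
    by move=> q; rewrite mem_cat => /orP[/zc//|/mapP[q' /zc' h ->]].
  move=> y; rewrite /csub.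
  have -> : bd1 (z ++ cscale (-1) z') = bd1 z ++ cscale (-1) (bd1 z').
    rewrite /bd1 map_cat flatten_cat; congr (_ ++ _).
    rewrite /cscale map_flatten -!map_comp; congr flatten; apply: eq_map => q /=.
    by rewrite mulrN.
  rewrite coef_cat coef_scale (funext z0) (funext z0').
  by rewrite /coef !big_nil mulrN1z subrr.
have [|[E [EA iE genE]] [M M0 hM]] := @cyclic_sum_of_fg_mul Q N s A N0 hA.
  by move=> _ [z hz <-]; exact: hN.
split; last first.
  exists M; split=> // z hz [n [n0 /p0 tz]].
  apply/p0; rewrite -/(hclass p _) hclass_scale -pmulrn; apply: hM.
    by exists z.
  by exists n => //; move: tz; rewrite -/(hclass p _) hclass_scale -pmulrn.
(* Representing cycles for the independent generators, which themselves serve as indices. *)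
have /choice [g hg] : forall c : set_type E, exists z, cycle1 z /\ hclass p z = val c.
  by move=> c; have [z hz zE] := EA _ (set_valP c); exists z.
exists (set_type E), g; split; first by move=> c; have [] := hg c.
split.
  move=> z hz; have [l [n [lE zE]]] : exists l (n : Q -> int),
      (forall y, y \in l -> E y) /\ hclass p z = \sum_(y <- l) y *~ n y.
    by apply: gen_comb; apply: genE; exists z.
  have [l' l'E] : exists l' : seq (set_type E), l = map val l'.
    elim: l lE {zE} => [|y l IH] lE; first by exists [::].
    have [|l' ->] := IH; first by move=> u ul; apply: lE; rewrite in_cons ul orbT.
    by exists (SigSub (mem_set (lE y (mem_head _ _))) :: l').
  exists l', (fun c => n (val c)); apply/(hclass_homologous p0).
  rewrite (hclass_comb p0) zE l'E big_map; apply: eq_bigr => c _.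
  by have [_ ->] := hg c.
move=> l n ul /p0; rewrite -/(hclass p _) (hclass_comb p0) => s0 c cl.
apply/p0; rewrite -/(hclass p _) hclass_scale.
have e c' : hclass p (g c') = val c' by have [] := hg c'.
rewrite e; apply: (indep_family iE ul _ _ _ cl); first by move=> ? ? _ _; exact: val_inj.
  by move=> c' _; exact: set_valP.
by rewrite -[RHS]s0; apply: eq_bigr => c' _; rewrite e.
Qed.
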